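(* The geometric realization of $C(n_1,n_2,n_3)$ is a surface with nonempty boundary if and only if one of the following holds: (1) $n_1=n_2=n_3$; (2) $n_1=n_2<n_3$ and $n_3\neq N/2$; (3) $n_1<n_2=n_3$.
   Context: Standing conventions: $N,n_1,n_2,n_3$ are positive integers with $n_1+n_2+n_3=N$ and $1\le n_1\le n_2\le n_3<N$. $C(n_1,n_2,n_3)$ denotes the abstract simplicial complex whose vertex set is $\mathbb{Z}/N$, whose 2-simplices are all sets of the form $\{k,k+n_1,k+n_1+n_2\}$ or $\{k,k-n_1,k-n_1-n_2\}$ for $k\in\mathbb{Z}/N$ (i.e. the orbit of $\{0,n_1,n_1+n_2\}$ under all translations $x\mapsto x+t$ and inversions $x\mapsto t-x$ of $\mathbb{Z}/N$), and whose 1-simplices are all sets $\{k,k+n_i\}$ with $k\in\mathbb{Z}/N$, $i\in\{1,2,3\}$. A surface with boundary is a second countable Hausdorff space each point of which has a neighborhood homeomorphic to an open subset of $\{(x,y)\in\mathbb{R}^2:y\ge 0\}$; its boundary consists of points having no neighborhood homeomorphic to an open subset of $\mathbb{R}^2$. *)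

(* Defs.v *)
From Stdlib Require Import Reals Arith.
Open Scope R_scope.

(* Points of R^N are represented as functions nat -> R; coordinates v >= N are
   ignored by the metric (and are 0 on the geometric realization). *)
Definition pt := nat -> R.

Fixpoint rsum (f : nat -> R) (n : nat) : R :=
  match n with O => 0 | S m => rsum f m + f m end.

Definition closeN (N : nat) (x y : pt) (d : R) : Prop :=
  forall v, (v < N)%nat -> Rabs (x v - y v) < d.

Definition close2 (p q : R * R) (d : R) : Prop :=
  Rabs (fst p - fst q) < d /\ Rabs (snd p - snd q) < d.

Definition tri_plus (N n1 n2 k v : nat) : Prop :=
  v = k \/ v = ((k + n1) mod N)%nat \/ v = ((k + n1 + n2) mod N)%nat.

Definition tri_minus (N n1 n2 k v : nat) : Prop :=
  v = k \/ v = ((k + (N - n1)) mod N)%nat \/ v = ((k + (N - (n1 + n2))) mod N)%nat.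

Definition edge (N m k v : nat) : Prop :=
  v = k \/ v = ((k + m) mod N)%nat.

Definition is_simplex (N n1 n2 n3 : nat) (S : nat -> Prop) : Prop :=
  exists k, (k < N)%nat /\
    ( (forall v, S v <-> tri_plus N n1 n2 k v)
   \/ (forall v, S v <-> tri_minus N n1 n2 k v)
   \/ (forall v, S v <-> edge N n1 k v)
   \/ (forall v, S v <-> edge N n2 k v)
   \/ (forall v, S v <-> edge N n3 k v)
   \/ (forall v, S v <-> v = k) ).

(* geometric realization |C(n1,n2,n3)| inside R^N: barycentric coordinate
   vectors whose support is contained in (the vertex set of) some simplex *)
Definition realization (N n1 n2 n3 : nat) (x : pt) : Prop :=
  (forall v, (v < N)%nat -> 0 <= x v) /\
  (forall v, (N <= v)%nat -> x v = 0) /\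
  rsum x N = 1 /\
  exists S, is_simplex N n1 n2 n3 S /\ (forall v, x v <> 0 -> S v).

Definition openN (N : nat) (X U : pt -> Prop) : Prop :=
  (forall x, U x -> X x) /\
  forall u, U u -> exists d, 0 < d /\ forall x, X x -> closeN N u x d -> U x.

Definition open2 (Y V : R * R -> Prop) : Prop :=
  (forall p, V p -> Y p) /\
  forall p, V p -> exists d, 0 < d /\ forall q, Y q -> close2 p q d -> V q.

Definition plane (p : R * R) : Prop := True.
Definition half_plane (p : R * R) : Prop := 0 <= snd p.

Definition homeomorphic (N : nat) (U : pt -> Prop) (V : R * R -> Prop) : Prop :=
  exists (f : pt -> R * R) (g : R * R -> pt),
    (forall x, U x -> V (f x)) /\
    (forall p, V p -> U (g p)) /\
    (forall x, U x -> g (f x) = x) /\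
    (forall p, V p -> f (g p) = p) /\
    (forall x, U x -> forall e, 0 < e -> exists d, 0 < d /\
        forall y, U y -> closeN N x y d -> close2 (f x) (f y) e) /\
    (forall p, V p -> forall e, 0 < e -> exists d, 0 < d /\
        forall q, V q -> close2 p q d -> closeN N (g p) (g q) e).

(* every point of X has an open neighborhood homeomorphic to an open subset
   of the closed upper half-plane (X is a subspace of R^N, hence automatically
   Hausdorff and second countable) *)
Definition is_surface_with_boundary (N : nat) (X : pt -> Prop) : Prop :=
  forall x, X x -> exists U V,
    openN N X U /\ U x /\ open2 half_plane V /\ homeomorphic N U V.

(* x is a boundary point of X: no neighborhood of x in X is homeomorphic to an
   open subset of R^2 (it suffices to consider open neighborhoods) *)
Definition is_boundary_point (N : nat) (X : pt -> Prop) (x : pt) : Prop :=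
  X x /\ ~ exists U V,
    openN N X U /\ U x /\ open2 plane V /\ homeomorphic N U V.

(* Main.v *)
Require Import Defs.
From Stdlib Require Import Reals Arith ZArith Lra Lia List FunctionalExtensionality.
From Coquelicot Require Import Coquelicot.
Import ListNotations.
Open Scope R_scope.
Set Bullet Behavior "Strict Subproofs".

(** The open star of a vertex is the open cone over its link. The link is an edge when
    n1 = n2 = n3, a path with three edges in the other two listed cases, a triangle or a
    hexagon when the complex is a closed surface, and a hexagon with two opposite vertices
    identified when n1 < n2 < n3 = N/2. Cones over paths and cycles are flattened piecewise
    linearly onto a half-plane or a plane.

    Both obstructions come from winding numbers. The centre of a half-disc is not an interior
    point of a planar chart: a small circle around it would bound in the punctured half-disc,
    which is star-shaped. If n3 = N/2, four triangles meet along the edge {0, n3}; near its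
    midpoint x, flattening two different pages of this book gives a pair of degrees on loops
    avoiding x, and two loops with the independent pairs (1, -1) and (1, 0) cannot both live in
    a punctured disc (where all pairs are multiples of one vector) or in a punctured half-disc. *)

(** * Continuity and angle lifting *)

(** A boundary point is defined by the absence of planar charts, so the two directions need
    different tools. The closed-surface cases only require planar charts around every point.
    Exhibiting a boundary point, or refuting every chart on the book, means excluding arbitrary
    unknown homeomorphisms. The winding arguments must therefore work for merely continuous loops: a
    degree is the increment over [-PI, PI] of a real-valued continuous angle, and lifting angles
    over a whole rectangle yields homotopy invariance directly. For the book, one flattening is not
    enough. Around an interior point of a chart, a single degree could take any value consistently;
    only the comparison of two flattenings on two loops shows that the local loops are not all
    multiples of one generator. Charts are built at vertices only, because barycentric coordinates
    sum to 1 and so every point lies in some open star. *)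

Definition closeR (x y d : R) : Prop := Rabs (x - y) < d.

(* [homeomorphic] unfolds to this notion with [closeN N] and [close2] as "metrics". *)
Definition cont {A B : Type} (dA : A -> A -> R -> Prop) (dB : B -> B -> R -> Prop)
  (D : A -> Prop) (f : A -> B) : Prop :=
  forall x, D x -> forall e, 0 < e -> exists d, 0 < d /\
    forall y, D y -> dA x y d -> dB (f x) (f y) e.

Lemma cont_comp {A B C : Type} (dA : A -> A -> R -> Prop) (dB : B -> B -> R -> Prop)
  (dC : C -> C -> R -> Prop) (D : A -> Prop) (D' : B -> Prop) (f : A -> B) (g : B -> C) :
  cont dA dB D f -> cont dB dC D' g -> (forall x, D x -> D' (f x)) ->
  cont dA dC D (fun x => g (f x)).
Proof.
  intros Hf Hg HD x Hx e He.
  destruct (Hg (f x) (HD x Hx) e He) as [d [Hd Hg']].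
  destruct (Hf x Hx d Hd) as [d' [Hd' Hf']].
  exists d'; split; [exact Hd'|]; intros y Hy Hxy; auto.
Qed.

Lemma cont_ext {A B : Type} (dA : A -> A -> R -> Prop) (dB : B -> B -> R -> Prop)
  (D : A -> Prop) (f g : A -> B) :
  (forall x, D x -> f x = g x) -> cont dA dB D f -> cont dA dB D g.
Proof.
  intros H Hf x Hx e He; destruct (Hf x Hx e He) as [d [Hd Hf']].
  exists d; split; [exact Hd|]; intros y Hy Hxy.
  rewrite <- (H x Hx), <- (H y Hy); auto.
Qed.

Lemma cont_sub {A B : Type} (dA : A -> A -> R -> Prop) (dB : B -> B -> R -> Prop)
  (D D' : A -> Prop) (f : A -> B) :
  (forall x, D' x -> D x) -> cont dA dB D f -> cont dA dB D' f.
Proof.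
  intros H Hf x Hx e He; destruct (Hf x (H x Hx) e He) as [d [Hd Hf']].
  exists d; split; auto.
Qed.

Lemma cont_lipschitz {A B : Type} (dA : A -> A -> R -> Prop) (dB : B -> B -> R -> Prop)
  (D : A -> Prop) (f : A -> B) (K : R) :
  0 < K -> (forall x y d, D x -> D y -> 0 < d -> dA x y d -> dB (f x) (f y) (K * d)) ->
  cont dA dB D f.
Proof.
  intros HK Hf x Hx e He; exists (e / K).
  assert (Hd : 0 < e / K) by (apply Rdiv_lt_0_compat; lra).
  split; [exact Hd|]; intros y Hy Hxy.
  replace e with (K * (e / K)) by (field; lra); auto.
Qed.

Section RealValued.

Context {A : Type} (dA : A -> A -> R -> Prop) (D : A -> Prop).
Hypothesis dA_mono : forall x y d d', dA x y d -> d <= d' -> dA x y d'.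

Lemma cont_const (c : R) : cont dA closeR D (fun _ => c).
Proof.
  intros x _ e He; exists 1; split; [lra|]; intros y _ _.
  unfold closeR; replace (c - c) with 0 by ring; rewrite Rabs_R0; exact He.
Qed.

Lemma cont_comp1 (h : R -> R) (f : A -> R) :
  cont dA closeR D f -> (forall x, D x -> continuity_pt h (f x)) ->
  cont dA closeR D (fun x => h (f x)).
Proof.
  intros Hf Hh x Hx e He.
  destruct (Hh x Hx e He) as [d [Hd Hh']].
  destruct (Hf x Hx d Hd) as [d' [Hd' Hf']].
  exists d'; split; [exact Hd'|]; intros y Hy Hxy; unfold closeR.
  destruct (Req_dec (f x) (f y)) as [<-|Hne].
  - replace (h (f x) - h (f x)) with 0 by ring; rewrite Rabs_R0; exact He.
  - rewrite Rabs_minus_sym; apply Hh'; split; [split; [exact I|exact Hne]|].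
    simpl; unfold R_dist; rewrite Rabs_minus_sym; apply Hf'; auto.
Qed.

Lemma cont_plus (f g : A -> R) :
  cont dA closeR D f -> cont dA closeR D g -> cont dA closeR D (fun x => f x + g x).
Proof.
  intros Hf Hg x Hx e He.
  destruct (Hf x Hx (e / 2)) as [d1 [Hd1 Hf']]; [lra|].
  destruct (Hg x Hx (e / 2)) as [d2 [Hd2 Hg']]; [lra|].
  exists (Rmin d1 d2); split; [apply Rmin_glb_lt; auto|]; intros y Hy Hxy.
  assert (H1 := Hf' y Hy (dA_mono _ _ _ _ Hxy (Rmin_l _ _))).
  assert (H2 := Hg' y Hy (dA_mono _ _ _ _ Hxy (Rmin_r _ _))).
  unfold closeR in *; apply Rabs_def2 in H1, H2; apply Rabs_def1; lra.
Qed.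

Lemma cont_scal (c : R) (f : A -> R) :
  cont dA closeR D f -> cont dA closeR D (fun x => c * f x).
Proof.
  intros Hf; apply (cont_comp1 (fun t => c * t)); [exact Hf|]; intros; reg.
Qed.

Lemma cont_minus (f g : A -> R) :
  cont dA closeR D f -> cont dA closeR D g -> cont dA closeR D (fun x => f x - g x).
Proof.
  intros Hf Hg; apply (cont_ext _ _ _ (fun x => f x + (-1) * g x)); [intros; ring|].
  apply cont_plus; [exact Hf|apply cont_scal, Hg].
Qed.

(* polarization *)
Lemma cont_mult (f g : A -> R) :
  cont dA closeR D f -> cont dA closeR D g -> cont dA closeR D (fun x => f x * g x).
Proof.
  intros Hf Hg.
  apply (cont_ext _ _ _ (fun x => / 4 * (Rsqr (f x + g x) - Rsqr (f x - g x))));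
    [intros; unfold Rsqr; field|].
  apply cont_scal, cont_minus.
  - apply (cont_comp1 Rsqr); [apply cont_plus; auto|intros; reg].
  - apply (cont_comp1 Rsqr); [apply cont_minus; auto|intros; reg].
Qed.

Lemma cont_inv (f : A -> R) :
  cont dA closeR D f -> (forall x, D x -> f x <> 0) -> cont dA closeR D (fun x => / f x).
Proof.
  intros Hf Hn; apply (cont_comp1 Rinv); [exact Hf|].
  intros x Hx; apply (continuity_pt_inv id); [reg|exact (Hn x Hx)].
Qed.

Lemma cont_pair (f g : A -> R) :
  cont dA closeR D f -> cont dA closeR D g -> cont dA close2 D (fun x => (f x, g x)).
Proof.
  intros Hf Hg x Hx e He.
  destruct (Hf x Hx e He) as [d1 [Hd1 Hf']].
  destruct (Hg x Hx e He) as [d2 [Hd2 Hg']].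
  exists (Rmin d1 d2); split; [apply Rmin_glb_lt; auto|]; intros y Hy Hxy.
  split; simpl.
  - exact (Hf' y Hy (dA_mono _ _ _ _ Hxy (Rmin_l _ _))).
  - exact (Hg' y Hy (dA_mono _ _ _ _ Hxy (Rmin_r _ _))).
Qed.

Lemma cont_fst (f : A -> R * R) : cont dA close2 D f -> cont dA closeR D (fun x => fst (f x)).
Proof.
  intros Hf x Hx e He; destruct (Hf x Hx e He) as [d [Hd Hf']].
  exists d; split; [exact Hd|]; intros y Hy Hxy; apply (Hf' y Hy Hxy).
Qed.

Lemma cont_snd (f : A -> R * R) : cont dA close2 D f -> cont dA closeR D (fun x => snd (f x)).
Proof.
  intros Hf x Hx e He; destruct (Hf x Hx e He) as [d [Hd Hf']].
  exists d; split; [exact Hd|]; intros y Hy Hxy; apply (Hf' y Hy Hxy).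
Qed.

End RealValued.

Lemma closeR_mono (x y d d' : R) : closeR x y d -> d <= d' -> closeR x y d'.
Proof. unfold closeR; lra. Qed.

Lemma close2_mono (p q : R * R) (d d' : R) : close2 p q d -> d <= d' -> close2 p q d'.
Proof. unfold close2; lra. Qed.

Lemma closeN_mono (N : nat) (x y : pt) (d d' : R) : closeN N x y d -> d <= d' -> closeN N x y d'.
Proof. intros H Hd v Hv; specialize (H v Hv); lra. Qed.

Lemma cont_id {A : Type} (dA : A -> A -> R -> Prop) (D : A -> Prop) : cont dA dA D (fun x => x).
Proof. intros x _ e He; exists e; auto. Qed.

Ltac cont_tac :=
  match goal with
  | |- cont _ closeR _ (fun _ => ?c) => apply cont_const
  | |- cont _ closeR _ (fun x => _ + _) =>
      apply cont_plus; [solve [exact closeR_mono | exact close2_mono | apply closeN_mono]| |]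
  | |- cont _ closeR _ (fun x => _ - _) =>
      apply cont_minus; [solve [exact closeR_mono | exact close2_mono | apply closeN_mono]| |]
  | |- cont _ closeR _ (fun x => _ * _) =>
      apply cont_mult; [solve [exact closeR_mono | exact close2_mono | apply closeN_mono]| |]
  | |- cont _ close2 _ (fun x => (_, _)) =>
      apply cont_pair; [solve [exact closeR_mono | exact close2_mono | apply closeN_mono]| |]
  | |- cont _ _ _ (fun x => x) => apply cont_id
  | |- cont _ _ _ fst => apply (cont_fst _ _ (fun q => q)), cont_id
  | |- cont _ _ _ snd => apply (cont_snd _ _ (fun q => q)), cont_id
  | |- cont _ _ _ cos =>
      apply (cont_comp1 _ _ cos (fun t => t)); [apply cont_id|intros; apply continuity_cos]
  | |- cont _ _ _ sin =>
      apply (cont_comp1 _ _ sin (fun t => t)); [apply cont_id|intros; apply continuity_sin]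
  | |- cont _ _ _ (fun x => cos _) => apply (cont_comp1 _ _ cos); [|intros; apply continuity_cos]
  | |- cont _ _ _ (fun x => sin _) => apply (cont_comp1 _ _ sin); [|intros; apply continuity_sin]
  | |- cont _ _ _ (fun x => fst _) => apply cont_fst
  | |- cont _ _ _ (fun x => snd _) => apply cont_snd
  end.

(** * Compactness and connectedness on intervals and rectangles *)

Definition Icc (a b t : R) : Prop := a <= t <= b.

Definition Rect (a b c d : R) (q : R * R) : Prop := a <= fst q <= b /\ c <= snd q <= d.

(** Retraction of the line onto [a, b]: composing with it extends a function continuous on the
    interval alone to all of R, where the compactness and intermediate value theorems apply. *)
Definition clamp (a b t : R) : R := Rmax a (Rmin b t).

Lemma clamp_in (a b t : R) : a <= b -> a <= clamp a b t <= b.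
Proof. unfold clamp, Rmax, Rmin; repeat destruct Rle_dec; lra. Qed.

Lemma clamp_id (a b t : R) : a <= t <= b -> clamp a b t = t.
Proof. unfold clamp, Rmax, Rmin; repeat destruct Rle_dec; lra. Qed.

Lemma clamp_close (a b s t d : R) : Rabs (s - t) < d -> Rabs (clamp a b s - clamp a b t) < d.
Proof.
  intros H; assert (0 < d) by (pose proof (Rabs_pos (s - t)); lra).
  apply Rabs_def2 in H; apply Rabs_def1;
  unfold clamp, Rmax, Rmin; repeat destruct Rle_dec; lra.
Qed.

Lemma cont_clamp (a b : R) (f : R -> R) : a <= b ->
  cont closeR closeR (Icc a b) f -> continuity (fun t => f (clamp a b t)).
Proof.
  intros Hab Hf t e He.
  destruct (Hf _ (clamp_in a b t Hab) e He) as [d [Hd Hf']].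
  exists d; split; [exact Hd|]; intros s [_ Hs]; simpl in *; unfold R_dist in *.
  rewrite Rabs_minus_sym; apply Hf'; [exact (clamp_in a b s Hab)|].
  apply clamp_close; rewrite Rabs_minus_sym; exact Hs.
Qed.

Lemma cont_rect_uniform (a b c d : R) (f : R * R -> R) : a <= b -> c <= d ->
  cont close2 closeR (Rect a b c d) f ->
  forall e, 0 < e -> exists r, 0 < r /\
    forall p q, Rect a b c d p -> Rect a b c d q -> close2 p q r -> closeR (f p) (f q) e.
Proof.
  intros Hab Hcd Hf e He.
  destruct (uniform_continuity_2d (fun x y => f (clamp a b x, clamp c d y)) a b c d) with
    (eps := mkposreal e He) as [r Hr].
  - intros x y _ _ eps.
    destruct (Hf (clamp a b x, clamp c d y)) with (e := pos eps) as [r [Hr Hf']].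
    + split; apply clamp_in; auto.
    + apply cond_pos.
    + exists (mkposreal r Hr); simpl; intros u v Hu Hv.
      rewrite Rabs_minus_sym; apply Hf'.
      * split; apply clamp_in; auto.
      * split; simpl; apply clamp_close; rewrite Rabs_minus_sym; auto.
  - exists (pos r); split; [apply cond_pos|].
    intros [p1 p2] [q1 q2] [Hp1 Hp2] [Hq1 Hq2] [H1 H2]; simpl in *.
    specialize (Hr q1 q2 p1 p2 Hq1 Hq2 Hp1 Hp2 H1 H2).
    rewrite !clamp_id in Hr by auto; exact Hr.
Qed.

Lemma cont_bounded (a b : R) (f : R -> R) : a <= b -> cont closeR closeR (Icc a b) f ->
  exists M, forall t, a <= t <= b -> Rabs (f t) <= M.
Proof.
  intros Hab Hf.
  assert (Hc : cont closeR closeR (Icc a b) (fun t => Rabs (f t))).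
  { apply (cont_comp1 _ _ Rabs); [exact Hf|]; intros; apply Rcontinuity_abs. }
  destruct (continuity_ab_maj _ a b Hab (fun t _ => cont_clamp a b _ Hab Hc t)) as [m [Hm _]].
  eexists; intros t Ht; specialize (Hm t Ht).
  rewrite (clamp_id a b t Ht) in Hm; exact Hm.
Qed.

Lemma cont_2PI_multiple_constant (a b : R) (f : R -> R) : a <= b ->
  cont closeR closeR (Icc a b) f ->
  (forall t, a <= t <= b -> exists k : Z, f t = 2 * PI * IZR k) ->
  forall s t, a <= s <= b -> a <= t <= b -> f s = f t.
Proof.
  intros Hab Hf Hk.
  assert (main : forall s t, a <= s <= b -> a <= t <= b -> ~ f s < f t).
  { intros s t Hs Ht Hlt.
    pose proof PI_RGT_0 as HPI.
    destruct (Hk s Hs) as [i Hi], (Hk t Ht) as [j Hj].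
    assert (Hij : (i + 1 <= j)%Z).
    { enough (i < j)%Z by lia; apply lt_IZR; rewrite Hi, Hj in Hlt; nra. }
    apply IZR_le in Hij; rewrite plus_IZR in Hij.
    (* The value halfway between two consecutive multiples of 2 PI would be attained, making an even
       integer equal to an odd one. *)
    destruct (IVT_gen (fun t => f (clamp a b t)) s t (2 * PI * IZR i + PI)) as [u [_ Hu]].
    - apply cont_clamp; auto.
    - rewrite !clamp_id by auto; rewrite Rmin_left, Rmax_right by lra.
      rewrite Hi, Hj; split; nra.
    - destruct (Hk _ (clamp_in a b u Hab)) as [l Hl].
      rewrite Hl in Hu.
      assert (H : 2 * IZR l = 2 * IZR i + 1).
      { apply (Rmult_eq_reg_l PI); lra. }
      change 2 with (IZR 2) in H; change 1 with (IZR 1) in H.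
      rewrite <- !mult_IZR, <- plus_IZR in H; apply eq_IZR in H; lia. }
  intros s t Hs Ht.
  destruct (Rtotal_order (f s) (f t)) as [H|[H|H]]; [|exact H|];
    exfalso; eapply main; [| |exact H| | |exact H]; auto.
Qed.

(** A relation, because an argument is determined only modulo 2 PI; [0 < r] excludes the origin. *)
Definition angle (z : R * R) (th : R) : Prop :=
  exists r, 0 < r /\ fst z = r * cos th /\ snd z = r * sin th.

Lemma angle_unique (z : R * R) (s t : R) : angle z s -> angle z t ->
  exists k : Z, s - t = 2 * PI * IZR k.
Proof.
  intros [r [Hr [H1 H2]]] [r' [Hr' [H1' H2']]].
  rewrite H1 in H1'; rewrite H2 in H2'; clear H1 H2.
  pose proof (sin2_cos2 s) as Es; pose proof (sin2_cos2 t) as Et; unfold Rsqr in *.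
  assert (Hrr : r = r').
  { assert (r * r = r' * r').
    { transitivity ((r * cos s) * (r * cos s) + (r * sin s) * (r * sin s));
        [transitivity (r * r * (sin s * sin s + cos s * cos s)); [rewrite Es|]; ring|].
      rewrite H1', H2'.
      transitivity (r' * r' * (sin t * sin t + cos t * cos t)); [|rewrite Et]; ring. }
    nra. }
  subst r'; apply Rmult_eq_reg_l in H1', H2'; try lra.
  assert (Hc : cos (s - t) = 1) by (rewrite cos_minus, H1', H2'; lra).
  (* The half-angle formula turns cosine 1 into a zero of sine, and zeros of sine are the integer
     multiples of PI. *)
  assert (Hs : sin ((s - t) / 2) = 0).
  { replace (s - t) with (2 * ((s - t) / 2)) in Hc by field.
    rewrite cos_2a_sin in Hc; nra. }
  destruct (sin_eq_0_0 _ Hs) as [k Hk]; exists k; lra.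
Qed.

Definition dot (z w : R * R) : R := fst z * fst w + snd z * snd w.
Definition cross (z w : R * R) : R := fst z * snd w - snd z * fst w.

(** [dot] and [cross] are proportional to the cosine and sine of the turn from [z] to [w]. A
    positive [dot] keeps this turn within a right angle, where [atan] of the quotient recovers it;
    the formula is continuous in [z] and [w]. *)
Lemma angle_step (z w : R * R) (th : R) : angle z th -> 0 < dot z w ->
  angle w (th + atan (cross z w / dot z w)).
Proof.
  intros [r [Hr [H1 H2]]] Hd.
  set (phi := atan (cross z w / dot z w)).
  assert (Hcos : 0 < cos phi).
  { apply cos_gt_0; unfold phi; pose proof (atan_bound (cross z w / dot z w)); lra. }
  assert (Hsin : sin phi * dot z w = cross z w * cos phi).
  { assert (Ht : sin phi / cos phi = cross z w / dot z w).
    { change (tan phi = cross z w / dot z w); unfold phi; apply tan_atan. }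
    apply (f_equal (fun u => u * cos phi * dot z w)) in Ht.
    field_simplify in Ht; [lra|lra|lra]. }
  pose proof (sin2_cos2 th) as Et; unfold Rsqr in Et.
  set (A := dot z w) in *; set (B := cross z w) in *.
  assert (HA : A = r * cos th * fst w + r * sin th * snd w)
    by (unfold A, dot; rewrite H1, H2; ring).
  assert (HB : B = r * cos th * snd w - r * sin th * fst w)
    by (unfold B, cross; rewrite H1, H2; ring).
  assert (Hw1 : r * fst w = cos th * A - sin th * B)
    by (rewrite HA, HB; transitivity (r * fst w * (sin th * sin th + cos th * cos th));
        [rewrite Et|]; ring).
  assert (Hw2 : r * snd w = sin th * A + cos th * B)
    by (rewrite HA, HB; transitivity (r * snd w * (sin th * sin th + cos th * cos th));
        [rewrite Et|]; ring).
  exists (A / (r * cos phi)); split; [|split].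
  - apply Rdiv_lt_0_compat; nra.
  - rewrite cos_plus; apply (Rmult_eq_reg_l r); [|lra].
    rewrite Hw1.
    transitivity ((cos th * (A * cos phi) - sin th * (sin phi * A)) / cos phi);
      [rewrite Hsin; field; lra|field; lra].
  - rewrite sin_plus; apply (Rmult_eq_reg_l r); [|lra].
    rewrite Hw2.
    transitivity ((sin th * (A * cos phi) + cos th * (sin phi * A)) / cos phi);
      [rewrite Hsin; field; lra|field; lra].
Qed.

Lemma angle_exists (z : R * R) : z <> (0, 0) -> exists th, angle z th.
Proof.
  intros Hz.
  (* Some unit vector along a half-axis has positive scalar product with [z]; its angle is known,
     and one [angle_step] leads to [z]. *)
  assert (H : exists e th, angle e th /\ 0 < dot e z).
  { destruct z as [x y]; unfold dot; simpl.
    destruct (Rtotal_order x 0) as [Hx|[Hx|Hx]].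
    - exists (-1, 0), PI; split; [exists 1; simpl; rewrite cos_PI, sin_PI|simpl]; lra.
    - destruct (Rtotal_order y 0) as [Hy|[Hy|Hy]].
      + exists (0, -1), (- (PI / 2)); split;
          [exists 1; simpl; rewrite cos_neg, sin_neg, cos_PI2, sin_PI2|simpl]; lra.
      + subst; contradiction Hz; reflexivity.
      + exists (0, 1), (PI / 2); split; [exists 1; simpl; rewrite cos_PI2, sin_PI2|simpl]; lra.
    - exists (1, 0), 0; split; [exists 1; simpl; rewrite cos_0, sin_0|simpl]; lra. }
  destruct H as [e [th [He Hd]]]; eexists; apply (angle_step e); eauto.
Qed.

Definition norm2 (z : R * R) : R := sqrt (dot z z).

Lemma dot_pos (z : R * R) : z <> (0, 0) -> 0 < dot z z.
Proof.
  destruct z as [x y]; unfold dot; simpl; intros Hz.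
  destruct (Req_dec x 0) as [->|Hx]; [destruct (Req_dec y 0) as [->|Hy]|].
  - contradiction Hz; reflexivity.
  - assert (0 < y * y) by (apply Rsqr_pos_lt in Hy; exact Hy); lra.
  - assert (0 < x * x) by (apply Rsqr_pos_lt in Hx; exact Hx).
    assert (0 <= y * y) by apply Rle_0_sqr; lra.
Qed.

Lemma norm2_pos (z : R * R) : z <> (0, 0) -> 0 < norm2 z.
Proof. intros Hz; apply sqrt_lt_R0, dot_pos, Hz. Qed.

Lemma cont_norm2 {A : Type} (dA : A -> A -> R -> Prop) (D : A -> Prop) (c : A -> R * R) :
  (forall x y d d', dA x y d -> d <= d' -> dA x y d') ->
  cont dA close2 D c -> cont dA closeR D (fun q => norm2 (c q)).
Proof.
  intros Hm Hc; unfold norm2; apply (cont_comp1 _ _ sqrt).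
  - unfold dot; apply cont_plus; auto; apply cont_mult; auto;
      [apply cont_fst|apply cont_fst|apply cont_snd|apply cont_snd]; auto.
  - intros q _; apply continuity_pt_sqrt; unfold dot.
    pose proof (Rle_0_sqr (fst (c q))); pose proof (Rle_0_sqr (snd (c q))); unfold Rsqr in *; lra.
Qed.

Lemma rect_scale (a b c d l : R) (q : R * R) : a <= 0 <= b -> c <= 0 <= d -> 0 <= l <= 1 ->
  Rect a b c d q -> Rect a b c d (l * fst q, l * snd q).
Proof. intros Hab Hcd Hl [H1 H2]; split; simpl; nra. Qed.

(** The normalized map is uniformly continuous. Unit vectors u, v whose coordinates differ by less
    than 1/2 satisfy |u - v|^2 < 1/2, hence u.v = 1 - |u - v|^2 / 2 > 0. *)
Lemma rect_lift_small_angle (a b c d : R) (F : R * R -> R * R) : a <= 0 <= b -> c <= 0 <= d ->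
  cont close2 close2 (Rect a b c d) F -> (forall q, Rect a b c d q -> F q <> (0, 0)) ->
  exists r, 0 < r /\ forall p q, Rect a b c d p -> Rect a b c d q -> close2 p q r ->
    0 < dot (F p) (F q).
Proof.
  intros Hab Hcd Hc Hn.
  assert (Hi : cont close2 closeR (Rect a b c d) (fun q => / norm2 (F q))).
  { apply cont_inv; [apply cont_norm2; [exact close2_mono|exact Hc]|].
    intros q Hq; apply Rgt_not_eq, norm2_pos, Hn, Hq. }
  destruct (cont_rect_uniform a b c d (fun q => fst (F q) * / norm2 (F q)))
    with (e := / 2) as [r1 [Hr1 H1]]; try lra; [repeat cont_tac; auto|].
  destruct (cont_rect_uniform a b c d (fun q => snd (F q) * / norm2 (F q)))
    with (e := / 2) as [r2 [Hr2 H2]]; try lra; [repeat cont_tac; auto|].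
  exists (Rmin r1 r2); split; [apply Rmin_glb_lt; auto|]; intros p q Hp Hq Hpq.
  specialize (H1 p q Hp Hq (close2_mono _ _ _ _ Hpq (Rmin_l _ _))).
  specialize (H2 p q Hp Hq (close2_mono _ _ _ _ Hpq (Rmin_r _ _))).
  assert (Hu : forall z, z <> (0, 0) ->
    (fst z * / norm2 z) * (fst z * / norm2 z) + (snd z * / norm2 z) * (snd z * / norm2 z) = 1).
  { intros z Hz; pose proof (norm2_pos z Hz) as Hpos.
    assert (E : norm2 z * norm2 z = dot z z) by (apply sqrt_sqrt, Rlt_le, dot_pos, Hz).
    unfold dot in E; field_simplify; [|lra].
    replace (fst z ^ 2 + snd z ^ 2) with (norm2 z ^ 2) by (simpl; lra); field; lra. }
  pose proof (norm2_pos _ (Hn p Hp)) as Pp; pose proof (norm2_pos _ (Hn q Hq)) as Pq.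
  pose proof (Hu _ (Hn p Hp)) as Up; pose proof (Hu _ (Hn q Hq)) as Uq.
  replace (dot (F p) (F q)) with (norm2 (F p) * norm2 (F q) *
    ((fst (F p) * / norm2 (F p)) * (fst (F q) * / norm2 (F q)) +
     (snd (F p) * / norm2 (F p)) * (snd (F q) * / norm2 (F q))))
    by (unfold dot; field; lra).
  unfold closeR in H1, H2; apply Rabs_def2 in H1, H2.
  revert H1 H2 Up Uq.
  generalize (fst (F p) * / norm2 (F p)) (snd (F p) * / norm2 (F p))
    (fst (F q) * / norm2 (F q)) (snd (F q) * / norm2 (F q)).
  intros x1 y1 x2 y2 H1 H2 Up Uq.
  apply Rmult_lt_0_compat; [nra|].
  assert ((x1 - x2) * (x1 - x2) < / 4) by nra.
  assert ((y1 - y2) * (y1 - y2) < / 4) by nra.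
  nra.
Qed.

(* The angle is accumulated along the segment from the origin to [q], cut into so many
   pieces that consecutive values of [F] always have positive scalar product. *)
Lemma rect_lift (a b c d : R) (F : R * R -> R * R) : a <= 0 <= b -> c <= 0 <= d ->
  cont close2 close2 (Rect a b c d) F -> (forall q, Rect a b c d q -> F q <> (0, 0)) ->
  exists th, cont close2 closeR (Rect a b c d) th /\
    forall q, Rect a b c d q -> angle (F q) (th q).
Proof.
  intros Hab Hcd Hc Hn.
  destruct (rect_lift_small_angle a b c d F Hab Hcd Hc Hn) as [r [Hr Hdot]].
  (* One n-th of any segment from the origin moves each coordinate by less than [r], the sides of
     the rectangle bounding the coordinates. The added 1 keeps the denominator positive for
     degenerate rectangles. *)
  destruct (archimed_cor1 (r / (1 + (b - a) + (d - c)))) as [n [Hn1 Hn2]].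
  { apply Rdiv_lt_0_compat; lra. }
  assert (HnR : 0 < INR n) by (apply lt_0_INR; lia).
  set (sc := fun (j : nat) (q : R * R) => (INR j * / INR n * fst q, INR j * / INR n * snd q)).
  assert (Hj01 : forall j, (j <= n)%nat -> 0 <= INR j * / INR n <= 1).
  { intros j Hj; apply le_INR in Hj; pose proof (pos_INR j).
    split; [apply Rmult_le_pos; [lra|apply Rlt_le, Rinv_0_lt_compat; lra]|].
    apply (Rmult_le_reg_r (INR n)); [lra|]; field_simplify; lra. }
  assert (Hsc : forall j q, (j <= n)%nat -> Rect a b c d q -> Rect a b c d (sc j q)).
  { intros j q Hj Hq; apply rect_scale; auto. }
  assert (Hcsc : forall j, (j <= n)%nat ->
            cont close2 close2 (Rect a b c d) (fun q => F (sc j q))).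
  { intros j Hj; eapply cont_comp; [|exact Hc|intros q Hq; apply Hsc; [exact Hj|exact Hq]].
    unfold sc; repeat cont_tac. }
  assert (Hclose : forall j q, Rect a b c d q -> close2 (sc j q) (sc (S j) q) r).
  { intros j q [Hq1 Hq2]; unfold sc; rewrite S_INR.
    assert (Hin : 0 < / INR n) by (apply Rinv_0_lt_compat; lra).
    assert (Hb : (1 + (b - a) + (d - c)) * / INR n < r).
    { apply (Rmult_lt_reg_r (/ (1 + (b - a) + (d - c)))); [apply Rinv_0_lt_compat; lra|].
      unfold Rdiv in Hn1; rewrite (Rmult_comm _ (/ INR n)), Rmult_assoc, Rinv_r by lra; lra. }
    split; simpl; apply Rabs_def1; nra. }
  assert (main : forall j, (j <= n)%nat -> exists th,
    cont close2 closeR (Rect a b c d) th /\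
    forall q, Rect a b c d q -> angle (F (sc j q)) (th q)).
  { induction j as [|j IH]; intros Hj.
    - assert (H0 : Rect a b c d (0, 0)) by (split; simpl; lra).
      destruct (angle_exists _ (Hn _ H0)) as [th0 Hth0].
      exists (fun _ => th0); split; [apply cont_const|]; intros q Hq.
      unfold sc; simpl; rewrite !Rmult_0_l; exact Hth0.
    - destruct IH as [th [Hth1 Hth2]]; [lia|].
      assert (Hp : forall q, Rect a b c d q -> 0 < dot (F (sc j q)) (F (sc (S j) q))).
      { intros q Hq; apply Hdot; [apply Hsc; [lia|auto]|apply Hsc; auto|apply Hclose; auto]. }
      exists (fun q => th q + atan (cross (F (sc j q)) (F (sc (S j) q)) *
                                    / dot (F (sc j q)) (F (sc (S j) q)))); split.
      + apply cont_plus; [exact close2_mono|exact Hth1|].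
        apply (cont_comp1 _ _ atan);
          [|intros; apply derivable_continuous_pt, derivable_pt_atan].
        assert (C1 := Hcsc j ltac:(lia)); assert (C2 := Hcsc (S j) Hj).
        apply cont_mult; [exact close2_mono| |apply cont_inv].
        * unfold cross; repeat first [cont_tac | assumption].
        * unfold dot; repeat first [cont_tac | assumption].
        * intros q Hq; apply Rgt_not_eq, Hp, Hq.
      + intros q Hq; apply angle_step; auto. }
  destruct (main n (le_n n)) as [th [Hth1 Hth2]].
  exists th; split; [exact Hth1|]; intros q Hq; specialize (Hth2 q Hq).
  unfold sc in Hth2; rewrite Rinv_r, !Rmult_1_l in Hth2 by lra.
  rewrite <- surjective_pairing in Hth2; exact Hth2.
Qed.

(** * Winding around the origin *)

Lemma cont_line (s a b c d : R) (G : R * R -> R) : a <= s <= b ->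
  cont close2 closeR (Rect a b c d) G -> cont closeR closeR (Icc c d) (fun t => G (s, t)).
Proof.
  intros Hs HG.
  apply (cont_comp closeR close2 closeR (Icc c d) (Rect a b c d) (fun t => (s, t)) G);
    [repeat cont_tac|exact HG|intros t Ht; split; simpl; auto].
Qed.

Lemma cont_col (t a b c d : R) (G : R * R -> R) : c <= t <= d ->
  cont close2 closeR (Rect a b c d) G -> cont closeR closeR (Icc a b) (fun s => G (s, t)).
Proof.
  intros Ht HG.
  apply (cont_comp closeR close2 closeR (Icc a b) (Rect a b c d) (fun s => (s, t)) G);
    [repeat cont_tac|exact HG|intros s Hs; split; simpl; auto].
Qed.

(** The interval is treated as a rectangle of width 0, which must contain the origin, where the
    lifting starts. *)
Lemma interval_lift (c d : R) (z : R -> R * R) : c <= 0 <= d ->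
  cont closeR close2 (Icc c d) z -> (forall t, c <= t <= d -> z t <> (0, 0)) ->
  exists th, cont closeR closeR (Icc c d) th /\ forall t, c <= t <= d -> angle (z t) (th t).
Proof.
  intros Hcd Hz Hn.
  destruct (rect_lift 0 0 c d (fun q => z (snd q))) as [th [H1 H2]]; try lra.
  - apply (cont_comp close2 closeR close2 _ (Icc c d) snd z); [cont_tac|exact Hz|].
    intros q [_ Hq]; exact Hq.
  - intros q [_ Hq]; apply Hn, Hq.
  - exists (fun t => th (0, t)); split.
    + apply (cont_line 0 0 0 c d th); [lra|exact H1].
    + intros t Ht; apply (H2 (0, t)); split; simpl; lra.
Qed.

Lemma angle_increment_unique (c d : R) (z : R -> R * R) (th th' : R -> R) :
  cont closeR closeR (Icc c d) th -> cont closeR closeR (Icc c d) th' ->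
  (forall t, c <= t <= d -> angle (z t) (th t)) ->
  (forall t, c <= t <= d -> angle (z t) (th' t)) ->
  forall s t, c <= s <= d -> c <= t <= d -> th t - th s = th' t - th' s.
Proof.
  intros C C' H H' s t Hs Ht.
  enough (th s - th' s = th t - th' t) by lra.
  apply (cont_2PI_multiple_constant c d (fun t => th t - th' t)); auto;
    [lra|repeat cont_tac; auto|].
  intros u Hu; eapply angle_unique; eauto.
Qed.

(** Lift the whole homotopy. Since each stage is a closed loop, its angle increment is a multiple of
    2 PI; it varies continuously with the stage, so it is constant. *)
Lemma homotopy_angle_increment (H : R * R -> R * R) (th0 th1 : R -> R) :
  cont close2 close2 (Rect 0 1 (- PI) PI) H ->
  (forall q, Rect 0 1 (- PI) PI q -> H q <> (0, 0)) ->
  (forall s, 0 <= s <= 1 -> H (s, - PI) = H (s, PI)) ->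
  cont closeR closeR (Icc (- PI) PI) th0 -> cont closeR closeR (Icc (- PI) PI) th1 ->
  (forall t, - PI <= t <= PI -> angle (H (0, t)) (th0 t)) ->
  (forall t, - PI <= t <= PI -> angle (H (1, t)) (th1 t)) ->
  th0 PI - th0 (- PI) = th1 PI - th1 (- PI).
Proof.
  intros C Hn Hcl C0 C1 A0 A1.
  pose proof PI_RGT_0 as HPI.
  destruct (rect_lift 0 1 (- PI) PI H) as [th [Cth Ath]]; auto; try lra.
  assert (E0 : th0 PI - th0 (- PI) = th (0, PI) - th (0, - PI)).
  { apply (angle_increment_unique (- PI) PI (fun t => H (0, t)) th0 (fun t => th (0, t)));
      auto; try lra.
    - apply (cont_line 0 0 1); auto; lra.
    - intros t Ht; apply Ath; split; simpl; lra. }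
  assert (E1 : th1 PI - th1 (- PI) = th (1, PI) - th (1, - PI)).
  { apply (angle_increment_unique (- PI) PI (fun t => H (1, t)) th1 (fun t => th (1, t)));
      auto; try lra.
    - apply (cont_line 1 0 1); auto; lra.
    - intros t Ht; apply Ath; split; simpl; lra. }
  rewrite E0, E1.
  apply (cont_2PI_multiple_constant 0 1 (fun s => th (s, PI) - th (s, - PI))); try lra.
  - cont_tac; [apply (cont_col PI 0 1 (- PI) PI)|apply (cont_col (- PI) 0 1 (- PI) PI)]; auto; lra.
  - intros s Hs; apply (angle_unique (H (s, PI))).
    + apply Ath; split; simpl; lra.
    + rewrite <- Hcl by lra; apply Ath; split; simpl; lra.
Qed.

Lemma circle_not_null_homotopic (H : R * R -> R * R) (rho : R) (z : R * R) : 0 < rho ->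
  cont close2 close2 (Rect 0 1 (- PI) PI) H ->
  (forall q, Rect 0 1 (- PI) PI q -> H q <> (0, 0)) ->
  (forall s, 0 <= s <= 1 -> H (s, - PI) = H (s, PI)) ->
  (forall t, - PI <= t <= PI -> H (0, t) = (rho * cos t, rho * sin t)) ->
  (forall t, - PI <= t <= PI -> H (1, t) = z) -> False.
Proof.
  intros Hr C Hn Hcl H0 H1; pose proof PI_RGT_0 as HPI.
  destruct (angle_exists z) as [w Hw].
  { rewrite <- (H1 0) by lra; apply Hn; split; simpl; lra. }
  assert (E : PI - - PI = w - w).
  { apply (homotopy_angle_increment H (fun t => t) (fun _ => w)); auto.
    - apply cont_id.
    - apply cont_const.
    - intros t Ht; rewrite H0 by exact Ht; exists rho; simpl; auto.
    - intros t Ht; rewrite H1 by exact Ht; exact Hw. }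
  lra.
Qed.

(** Restricted to a window because lifts are available only over bounded intervals; the intermediate
    points lie between [s] and [t] and never leave it. *)
Lemma quasi_periodic_iter (M K : R) (eta : R -> R) :
  (forall t, - M <= t -> t + 2 * PI <= M -> eta (t + 2 * PI) = eta t + K) ->
  forall (m : Z) s t, - M <= s <= M -> - M <= t <= M -> t = s + 2 * PI * IZR m ->
  eta t = eta s + K * IZR m.
Proof.
  intros Heta; pose proof PI_RGT_0 as HPI.
  assert (nat_case : forall (n : nat) s t, - M <= s -> t <= M -> t = s + 2 * PI * INR n ->
    eta t = eta s + K * INR n).
  { induction n as [|n IH]; intros s t Hs Ht Hst.
    - replace t with s by (simpl in Hst; lra); simpl; ring.
    - rewrite S_INR in *; pose proof (pos_INR n).
      assert (0 <= PI * INR n) by nra.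
      replace t with ((t - 2 * PI) + 2 * PI) by ring.
      rewrite Heta by lra; rewrite (IH s (t - 2 * PI)) by lra; ring. }
  intros m s t Hs Ht Hst; destruct (Z.le_gt_cases 0 m) as [Hm|Hm].
  - assert (E : IZR m = INR (Z.to_nat m)) by (rewrite INR_IZR_INZ, Z2Nat.id; auto).
    rewrite E in *; apply nat_case; lra.
  - assert (E : IZR m = - INR (Z.to_nat (- m)))
      by (rewrite INR_IZR_INZ, Z2Nat.id, opp_IZR by lia; ring).
    rewrite E in *; rewrite (nat_case (Z.to_nat (- m)) t s); lra.
Qed.

(** * Polar coordinates and degrees in a punctured disc *)

Definition polar (p : R * R) (r t : R) : R * R := (fst p + r * cos t, snd p + r * sin t).

Lemma polar_close (p : R * R) (r t e : R) : Rabs r < e -> close2 p (polar p r t) e.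
Proof.
  intros Hr; pose proof (Rabs_pos r).
  assert (Hb : forall a u, Rabs u <= 1 -> Rabs (a - (a + r * u)) < e).
  { intros a u Hu; replace (a - (a + r * u)) with (- (r * u)) by ring.
    rewrite Rabs_Ropp, Rabs_mult; pose proof (Rabs_pos u); nra. }
  split; apply Hb, Rabs_le; [apply COS_bound|apply SIN_bound].
Qed.

Lemma polar_neq (p : R * R) (r t : R) : 0 < r -> polar p r t <> p.
Proof.
  intros Hr E; unfold polar in E; destruct p as [x y]; simpl in E.
  injection E as E1 E2.
  assert (cos t = 0) by nra; assert (sin t = 0) by nra.
  pose proof (sin2_cos2 t) as S; unfold Rsqr in S; nra.
Qed.

Lemma polar_2PI (p : R * R) (r t : R) : polar p r (t + 2 * PI) = polar p r t.
Proof.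
  unfold polar; replace (t + 2 * PI) with (t + 2 * INR 1 * PI) by (simpl; ring).
  rewrite cos_period, sin_period; reflexivity.
Qed.

Lemma polar_2PI_Z (p : R * R) (r t : R) (m : Z) :
  polar p r (t + 2 * PI * IZR m) = polar p r t.
Proof.
  (* [cos] and [sin] are quasi-periodic with increment 0, and this window contains both
     endpoints. *)
  pose proof (quasi_periodic_iter (Rabs t + Rabs (t + 2 * PI * IZR m)) 0) as Q.
  pose proof (Rle_abs t); pose proof (Rle_abs (- t)).
  pose proof (Rle_abs (t + 2 * PI * IZR m)); pose proof (Rle_abs (- (t + 2 * PI * IZR m))).
  rewrite Rabs_Ropp in *; pose proof (Rabs_pos t); pose proof (Rabs_pos (t + 2 * PI * IZR m)).
  unfold polar; f_equal; f_equal; f_equal.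
  - rewrite (Q cos) with (m := m) (s := t); try lra.
    intros u _ _; rewrite cos_plus, cos_2PI, sin_2PI; ring.
  - rewrite (Q sin) with (m := m) (s := t); try lra.
    intros u _ _; rewrite sin_plus, cos_2PI, sin_2PI; ring.
Qed.

Lemma cont_polar {A : Type} (dA : A -> A -> R -> Prop) (D : A -> Prop) (p : R * R) (r t : A -> R) :
  (forall x y d d', dA x y d -> d <= d' -> dA x y d') ->
  cont dA closeR D r -> cont dA closeR D t -> cont dA close2 D (fun x => polar p (r x) (t x)).
Proof.
  intros Hm Hr Ht; unfold polar.
  apply cont_pair; auto; apply cont_plus; auto; try apply cont_const; apply cont_mult; auto;
    repeat cont_tac; auto.
Qed.

Lemma diff_neq (p q : R * R) : p <> q -> (fst p - fst q, snd p - snd q) <> (0, 0).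
Proof.
  intros H E; apply H; injection E as E1 E2.
  rewrite (surjective_pairing p), (surjective_pairing q); f_equal; lra.
Qed.

Lemma polar_of_angle (p q : R * R) (t : R) :
  angle (fst q - fst p, snd q - snd p) t ->
  q = polar p (norm2 (fst q - fst p, snd q - snd p)) t.
Proof.
  intros [r [Hr [H1 H2]]]; simpl in H1, H2.
  assert (E : norm2 (fst q - fst p, snd q - snd p) = r).
  { unfold norm2, dot; simpl; rewrite H1, H2.
    replace (r * cos t * (r * cos t) + r * sin t * (r * sin t)) with
      (r * r * (Rsqr (sin t) + Rsqr (cos t))) by (unfold Rsqr; ring).
    rewrite sin2_cos2, Rmult_1_r; apply sqrt_square; lra. }
  rewrite E; unfold polar; rewrite <- H1, <- H2, (surjective_pairing q); simpl; f_equal; ring.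
Qed.

(** A square of half-width e/2 lies in the Euclidean disc of radius e / sqrt 2, which is less than
    e. *)
Lemma norm2_lt_close2 (p q : R * R) (e : R) : close2 p q (e / 2) ->
  norm2 (fst q - fst p, snd q - snd p) < e.
Proof.
  intros [H1 H2]; unfold norm2, dot; simpl.
  assert (He : 0 < e) by (pose proof (Rabs_pos (fst p - fst q)); lra).
  apply Rabs_def2 in H1, H2.
  assert (Hsq : forall u, - (e / 2) < u < e / 2 -> 0 <= u * u < e * e / 4)
    by (intros u Hu; split; nra).
  assert (S1 := Hsq (fst q - fst p) ltac:(lra)); assert (S2 := Hsq (snd q - snd p) ltac:(lra)).
  rewrite <- (sqrt_square e) by lra; apply sqrt_lt_1_alt; split; nra.
Qed.

(* A loop [z] in a punctured disc winding [m] times around [p] is homotopic to [m] times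
   the circle, so [h] maps it to a loop winding [m * k] times around the origin. *)
Lemma punctured_disc_degree (p : R * R) (e : R) (h : R * R -> R * R) : 0 < e ->
  cont close2 close2 (fun q => close2 p q e) h ->
  (forall q, close2 p q e -> q <> p -> h q <> (0, 0)) ->
  exists k : Z, forall (z : R -> R * R) (al th : R -> R) (m : Z),
    cont closeR close2 (Icc (- PI) PI) z -> z (- PI) = z PI ->
    (forall t, - PI <= t <= PI -> close2 p (z t) (e / 2) /\ z t <> p) ->
    cont closeR closeR (Icc (- PI) PI) al ->
    (forall t, - PI <= t <= PI -> angle (fst (z t) - fst p, snd (z t) - snd p) (al t)) ->
    al PI - al (- PI) = 2 * PI * IZR m ->
    cont closeR closeR (Icc (- PI) PI) th ->
    (forall t, - PI <= t <= PI -> angle (h (z t)) (th t)) ->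
    th PI - th (- PI) = 2 * PI * IZR k * IZR m.
Proof.
  intros He Ch Hh; pose proof PI_RGT_0 as HPI.
  (* The image of the reference circle of radius e/2; its winding number will be [k]. *)
  set (c := fun t => h (polar p (e / 2) t)).
  assert (Hin : forall t, close2 p (polar p (e / 2) t) e)
    by (intros t; apply polar_close; rewrite Rabs_pos_eq; lra).
  assert (Cc : forall D, cont closeR close2 D c).
  { intros D; apply (cont_comp closeR close2 close2 D (fun q => close2 p q e)
      (fun t => polar p (e / 2) t) h); auto.
    apply cont_polar; [exact closeR_mono|apply cont_const|apply cont_id]. }
  assert (Hc : forall t, c t <> (0, 0))
    by (intros t; apply Hh; [apply Hin|apply polar_neq; lra]).
  destruct (interval_lift (- PI) PI c) as [eta0 [Ceta0 Aeta0]]; auto; try lra.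
  destruct (angle_unique (c PI) (eta0 PI) (eta0 (- PI))) as [k Hk].
  { apply Aeta0; lra. }
  { replace (c PI) with (c (- PI)); [apply Aeta0; lra|].
    unfold c; rewrite <- (polar_2PI p _ (- PI)); do 2 f_equal; ring. }
  exists k; intros z al th m Cz Hcl Hz Cal Aal Hal Cth Ath.
  (* The angle [al] need not stay in [-PI, PI]. The lift [eta] of [c] covers all its values, and the
     extra PI makes its domain contain [-PI, PI], where it is compared with [eta0]. *)
  destruct (cont_bounded (- PI) PI al) as [M HM]; [lra|exact Cal|].
  assert (HM0 : 0 <= M) by (eapply Rle_trans; [apply Rabs_pos|apply (HM 0); lra]).
  destruct (interval_lift (- (M + PI)) (M + PI) c) as [eta [Ceta Aeta]]; auto; try lra.
  assert (Hqp : forall t, - (M + PI) <= t -> t + 2 * PI <= M + PI ->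
            eta (t + 2 * PI) = eta t + 2 * PI * IZR k).
  { intros t Ht1 Ht2.
    (* Both terms are angles of the same point of the closed curve [c], so their difference is
       constant and can be read off at -PI. *)
    assert (E : eta (t + 2 * PI) - eta t = eta (- PI + 2 * PI) - eta (- PI)).
    { apply (cont_2PI_multiple_constant (- (M + PI)) (M - PI) (fun t => eta (t + 2 * PI) - eta t));
        try lra.
      - assert (S : cont closeR closeR (Icc (- (M + PI)) (M - PI)) (fun t => eta (t + 2 * PI))).
        { apply (cont_comp closeR closeR closeR _ (Icc (- (M + PI)) (M + PI))
            (fun t => t + 2 * PI) eta); [repeat cont_tac|exact Ceta|].
          unfold Icc; intros; lra. }
        cont_tac; [exact S|].
        apply (cont_sub _ _ (Icc (- (M + PI)) (M + PI))); [unfold Icc; intros; lra|exact Ceta].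
      - intros u Hu; apply (angle_unique (c u)); [|apply Aeta; lra].
        replace (c u) with (c (u + 2 * PI)) by (unfold c; rewrite polar_2PI; reflexivity).
        apply Aeta; lra. }
    assert (E' : eta PI - eta (- PI) = eta0 PI - eta0 (- PI)).
    { apply (angle_increment_unique (- PI) PI c); try lra; auto.
      - apply (cont_sub _ _ (Icc (- (M + PI)) (M + PI))); [unfold Icc; intros; lra|exact Ceta].
      - intros u Hu; apply Aeta; lra. }
    replace (- PI + 2 * PI) with PI in E by ring; lra. }
  assert (HMb : forall t, - PI <= t <= PI -> - (M + PI) <= al t <= M + PI).
  { intros t Ht; specialize (HM t Ht); apply Rabs_le_between in HM; lra. }
  assert (Efin : eta (al PI) - eta (al (- PI)) = 2 * PI * IZR k * IZR m).
  { rewrite (quasi_periodic_iter (M + PI) (2 * PI * IZR k) eta Hqp m (al (- PI)) (al PI));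
      try apply HMb; lra. }
  rewrite <- Efin.
  set (rad := fun t => norm2 (fst (z t) - fst p, snd (z t) - snd p)).
  assert (Hrad : forall t, - PI <= t <= PI -> 0 < rad t < e).
  { intros t Ht; destruct (Hz t Ht) as [Hz1 Hz2]; split.
    - apply norm2_pos, diff_neq, Hz2.
    - apply norm2_lt_close2, Hz1. }
  assert (Crad : cont closeR closeR (Icc (- PI) PI) rad).
  { apply cont_norm2; [exact closeR_mono|]; repeat cont_tac; auto. }
  (* Radial homotopy: the angle [al] is kept while the radius moves from that of [z] to e/2. It
     never reaches 0, and each stage closes up because [al] increases by a multiple of 2 PI. *)
  set (r := fun q : R * R => (1 - fst q) * rad (snd q) + fst q * (e / 2)).
  assert (Hr : forall q, Rect 0 1 (- PI) PI q -> 0 < r q < e).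
  { intros q [Hq1 Hq2]; specialize (Hrad _ Hq2); unfold r; split; [|nra].
    destruct (Rle_lt_dec (fst q) (1 / 2)); nra. }
  assert (Csnd : forall f, cont closeR closeR (Icc (- PI) PI) f ->
            cont close2 closeR (Rect 0 1 (- PI) PI) (fun q => f (snd q))).
  { intros f Cf; apply (cont_comp close2 closeR closeR _ (Icc (- PI) PI) snd f);
      [cont_tac|exact Cf|intros q [_ Hq]; exact Hq]. }
  apply (homotopy_angle_increment (fun q => h (polar p (r q) (al (snd q)))) th
           (fun t => eta (al t))).
  - apply (cont_comp close2 close2 close2 _ (fun q => close2 p q e)
      (fun q => polar p (r q) (al (snd q))) h); [|exact Ch|].
    + apply cont_polar; [exact close2_mono| |apply Csnd, Cal].
      unfold r; repeat first [apply (Csnd rad), Crad | cont_tac].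
    + intros q Hq; apply polar_close; specialize (Hr q Hq); rewrite Rabs_pos_eq; lra.
  - intros q Hq; specialize (Hr q Hq); apply Hh; [apply polar_close; rewrite Rabs_pos_eq; lra|].
    apply polar_neq; lra.
  - intros s Hs; simpl.
    replace (r (s, PI)) with (r (s, - PI)) by (unfold r, rad; simpl; rewrite Hcl; reflexivity).
    replace (al PI) with (al (- PI) + 2 * PI * IZR m) by lra.
    rewrite polar_2PI_Z; reflexivity.
  - exact Cth.
  - apply (cont_comp closeR closeR closeR _ (Icc (- (M + PI)) (M + PI)) al eta); auto.
  - intros t Ht; simpl.
    replace (polar p (r (0, t)) (al t)) with (z t); [apply Ath, Ht|].
    rewrite (polar_of_angle p (z t) (al t)) at 1 by (apply Aal, Ht).
    f_equal; unfold r, rad; simpl; ring.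
  - intros t Ht; simpl.
    replace (r (1, t)) with (e / 2) by (unfold r; simpl; ring).
    apply Aeta, HMb, Ht.
Qed.

(** * Boundary points and books *)

Definition half_disc (p : R * R) (d : R) (q : R * R) : Prop := half_plane q /\ close2 p q d.

(* A half-disc punctured at its centre [p] is star-shaped about [(fst p, d / 2)]. *)
Lemma half_disc_loop_null (p : R * R) (d rho : R) (h : R * R -> R * R) (z : R -> R * R) :
  snd p = 0 -> 0 < d -> 0 < rho ->
  cont close2 close2 (half_disc p d) h ->
  (forall q, half_disc p d q -> q <> p -> h q <> (0, 0)) ->
  cont closeR close2 (Icc (- PI) PI) z -> z (- PI) = z PI ->
  (forall t, - PI <= t <= PI -> half_disc p d (z t) /\ z t <> p) ->
  (forall t, - PI <= t <= PI -> h (z t) = (rho * cos t, rho * sin t)) -> False.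
Proof.
  intros Hp Hd Hrho Ch Hh Cz Hcl Hz Hhz.
  (* Straight-line contraction to (fst p, d/2). For positive time the second coordinate is positive,
     so [p], lying on the axis, is avoided. *)
  set (K := fun q : R * R => ((1 - fst q) * fst (z (snd q)) + fst q * fst p,
                              (1 - fst q) * snd (z (snd q)) + fst q * (d / 2))).
  assert (HK : forall q, Rect 0 1 (- PI) PI q -> half_disc p d (K q) /\ K q <> p).
  { intros [s t] [Hs Ht]; simpl in Hs, Ht; destruct (Hz t Ht) as [[Hz1 [Hz2 Hz3]] Hz4].
    unfold half_plane in Hz1; apply Rabs_def2 in Hz2, Hz3; rewrite Hp in Hz3.
    unfold K; simpl; split.
    - split; [unfold half_plane; simpl; nra|].
      split; simpl; apply Rabs_def1; try rewrite Hp; nra.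
    - intros E; destruct p as [p1 p2]; simpl in *; injection E as E1 E2; subst p2.
      destruct (Req_dec s 0) as [->|Hs0].
      + apply Hz4; rewrite (surjective_pairing (z t)); f_equal; lra.
      + assert (0 < s) by lra; assert (0 <= (1 - s) * snd (z t)) by nra.
        assert (0 < s * (d / 2)) by nra; lra. }
  assert (Czs : cont close2 close2 (Rect 0 1 (- PI) PI) (fun q => z (snd q))).
  { apply (cont_comp close2 closeR close2 _ (Icc (- PI) PI) snd z);
      [cont_tac|exact Cz|intros q [_ Hq]; exact Hq]. }
  apply (circle_not_null_homotopic (fun q => h (K q)) rho (h (fst p, d / 2))); auto.
  - apply (cont_comp close2 close2 close2 _ (half_disc p d) K h);
      [|exact Ch|intros q Hq; apply HK, Hq].
    unfold K; repeat first [cont_tac | exact Czs].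
  - intros q Hq; apply Hh; apply HK, Hq.
  - intros s Hs; unfold K; simpl; rewrite Hcl; reflexivity.
  - intros t Ht; rewrite <- Hhz by exact Ht; f_equal; unfold K; simpl.
    rewrite (surjective_pairing (z t)); simpl; f_equal; ring.
  - intros t Ht; f_equal; unfold K; simpl; f_equal; ring.
Qed.

Definition homeo (N : nat) (U : pt -> Prop) (V : R * R -> Prop)
  (f : pt -> R * R) (g : R * R -> pt) : Prop :=
    (forall x, U x -> V (f x)) /\
    (forall p, V p -> U (g p)) /\
    (forall x, U x -> g (f x) = x) /\
    (forall p, V p -> f (g p) = p) /\
    cont (closeN N) close2 U f /\ cont close2 (closeN N) V g.

(** Suppose a planar chart [f'] also exists at [x]. A small circle around [f' x], transported by
    [g'] and [f], becomes a loop in the half-disc that avoids its centre. The transition back, [f']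
    after [g], recentred at [f' x], recovers the circle, contradicting [half_disc_loop_null]. *)
Lemma half_plane_chart_boundary (N : nat) (X U : pt -> Prop) (V : R * R -> Prop)
  (f : pt -> R * R) (g : R * R -> pt) (x : pt) :
  openN N X U -> U x -> open2 half_plane V -> homeo N U V f g -> snd (f x) = 0 ->
  is_boundary_point N X x.
Proof.
  intros [UX HU] Ux [VH HV] [fV [gU [gf [fg [Cf Cg]]]]] Hsnd.
  split; [apply UX, Ux|].
  intros [U' [V' [[UX' HU'] [Ux' [[_ HV'] [f' [g' [fV' [gU' [gf' [fg' [Cf' Cg']]]]]]]]]]]].
  change (cont (closeN N) close2 U' f') in Cf'; change (cont close2 (closeN N) V' g') in Cg'.
  destruct (HU x Ux) as [dU [HdU HU1]]; destruct (HU' x Ux') as [dU' [HdU' HU1']].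
  destruct (HV (f x) (fV x Ux)) as [dV [HdV HV1]].
  destruct (HV' (f' x) (fV' x Ux')) as [dV' [HdV' HV1']].
  destruct (Cg (f x) (fV x Ux) dU' HdU') as [d1 [Hd1 Hg1]]; rewrite gf in Hg1 by exact Ux.
  set (d := Rmin dV d1).
  assert (Hd : 0 < d) by (apply Rmin_glb_lt; auto).
  assert (HdV1 : forall q, half_disc (f x) d q -> V q).
  { intros q [Hq1 Hq2]; apply HV1; auto; eapply close2_mono; [exact Hq2|apply Rmin_l]. }
  assert (HdU1' : forall q, half_disc (f x) d q -> U' (g q)).
  { intros q Hq; apply HU1'; [apply UX, gU, HdV1, Hq|]; apply Hg1; [apply HdV1, Hq|].
    eapply close2_mono; [apply Hq|apply Rmin_r]. }
  destruct (Cf x Ux d Hd) as [d3 [Hd3 Hf3]].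
  destruct (Cg' (f' x) (fV' x Ux') (Rmin dU d3)) as [d2 [Hd2 Hg2]];
    [apply Rmin_glb_lt; auto|]; rewrite gf' in Hg2 by exact Ux'.
  (* Small enough that the circle lies in [V'] and that [g'] carries it into [U], so near [x] that
     [f] lands in the half-disc. *)
  set (rho := Rmin dV' d2 / 2).
  assert (Hrho : 0 < rho).
  { assert (0 < Rmin dV' d2) by (apply Rmin_glb_lt; auto); unfold rho; lra. }
  assert (Hrho1 : rho < dV') by (unfold rho in *; pose proof (Rmin_l dV' d2); lra).
  assert (Hrho2 : rho < d2) by (unfold rho in *; pose proof (Rmin_r dV' d2); lra).
  assert (HcV : forall t, V' (polar (f' x) rho t))
    by (intros t; apply HV1'; [exact I|]; apply polar_close; rewrite Rabs_pos_eq; lra).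
  assert (Hcl : forall t, closeN N x (g' (polar (f' x) rho t)) (Rmin dU d3))
    by (intros t; apply Hg2; auto; apply polar_close; rewrite Rabs_pos_eq; lra).
  assert (HcU : forall t, U (g' (polar (f' x) rho t))).
  { intros t; apply HU1; [apply UX', gU', HcV|].
    eapply closeN_mono; [apply Hcl|apply Rmin_l]. }
  apply (half_disc_loop_null (f x) d rho
    (fun q => (fst (f' (g q)) - fst (f' x), snd (f' (g q)) - snd (f' x)))
    (fun t => f (g' (polar (f' x) rho t)))); auto.
  - assert (C : cont close2 close2 (half_disc (f x) d) (fun q => f' (g q))).
    { apply (cont_comp close2 (closeN N) close2 _ U' g f'); auto.
      apply (cont_sub _ _ V); auto. }
    repeat first [cont_tac | exact C].
  - intros q Hq Hne; apply diff_neq; intros E; apply Hne.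
    assert (E' : g q = x) by (rewrite <- (gf' (g q)), <- (gf' x), E; auto).
    rewrite <- E', fg; auto.
  - apply (cont_comp closeR (closeN N) close2 _ U (fun t => g' (polar (f' x) rho t)) f); auto.
    apply (cont_comp closeR close2 (closeN N) _ V' (fun t => polar (f' x) rho t) g'); auto.
    apply cont_polar; [exact closeR_mono|apply cont_const|apply cont_id].
  - f_equal; f_equal; rewrite <- (polar_2PI _ _ (- PI)); f_equal; ring.
  - intros t _; split; [split|].
    + apply VH, fV, HcU.
    + apply Hf3; [apply HcU|]; eapply closeN_mono; [apply Hcl|apply Rmin_r].
    + intros E; apply (polar_neq (f' x) rho t Hrho).
      assert (E' : g' (polar (f' x) rho t) = x)
        by (transitivity (g (f (g' (polar (f' x) rho t)))); [symmetry; auto|rewrite E; auto]).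
      rewrite <- (fg' (polar (f' x) rho t)) by auto; rewrite E'; reflexivity.
  - intros t _; simpl; rewrite gf, fg' by auto; unfold polar; simpl; f_equal; ring.
Qed.

(* [F1] and [F2] flatten two different pages of a book; the loops [a] and [b] around [x] are
   sent by [(F1, F2)] to loops of degrees [(1, -1)] and [(1, 0)]. In a punctured disc all such
   pairs of degrees are multiples of one vector. *)
Lemma book_no_half_plane_chart (N : nat) (X : pt -> Prop) (x : pt) (F1 F2 : pt -> R * R) (d0 : R) :
  0 < d0 ->
  cont (closeN N) close2 X F1 -> cont (closeN N) close2 X F2 ->
  (forall y, X y -> closeN N x y d0 -> F1 y = (0, 0) \/ F2 y = (0, 0) -> y = x) ->
  (forall d, 0 < d -> exists rho (a b : R -> pt), 0 < rho /\
    cont closeR (closeN N) (Icc (- PI) PI) a /\ cont closeR (closeN N) (Icc (- PI) PI) b /\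
    a (- PI) = a PI /\ b (- PI) = b PI /\
    forall t, - PI <= t <= PI ->
      X (a t) /\ X (b t) /\ closeN N x (a t) d /\ closeN N x (b t) d /\ a t <> x /\ b t <> x /\
      F1 (a t) = (rho * cos t, rho * sin t) /\ F2 (a t) = (rho * cos t, - (rho * sin t)) /\
      F1 (b t) = (rho * cos t, rho * sin t) /\ F2 (b t) = (rho * cos t, - (rho * Rabs (sin t)))) ->
  ~ exists U V, openN N X U /\ U x /\ open2 half_plane V /\ homeomorphic N U V.
Proof.
  intros Hd0 C1 C2 HF Hloops [U [V [[UX HU] [Ux [[VH HV] [f [g [fV [gU [gf [fg [Cf Cg]]]]]]]]]]]].
  change (cont (closeN N) close2 U f) in Cf; change (cont close2 (closeN N) V g) in Cg.
  pose proof PI_RGT_0 as HPI.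
  destruct (HU x Ux) as [dU [HdU HU1]].
  destruct (HV (f x) (fV x Ux)) as [dV [HdV HV1]].
  destruct (Cg (f x) (fV x Ux) d0 Hd0) as [d1 [Hd1 Hg1]]; rewrite gf in Hg1 by exact Ux.
  assert (Hne : forall F, F = F1 \/ F = F2 -> forall q, V q -> close2 (f x) q d1 -> q <> f x ->
    F (g q) <> (0, 0)).
  { intros F HF12 q Vq Hq Hqx E; apply Hqx.
    rewrite <- (fg q Vq); f_equal; apply HF; [apply UX, gU, Vq|apply Hg1; auto|].
    destruct HF12 as [<- | <-]; auto. }
  assert (CF : forall F, F = F1 \/ F = F2 -> cont close2 close2 V (fun q => F (g q))).
  { intros F HF12; apply (cont_comp close2 (closeN N) close2 _ X g F); auto.
    destruct HF12 as [-> | ->]; auto. }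
  assert (Hloops' : forall d, 0 < d -> exists rho (a b : R -> R * R), 0 < rho /\
    cont closeR close2 (Icc (- PI) PI) a /\ cont closeR close2 (Icc (- PI) PI) b /\
    a (- PI) = a PI /\ b (- PI) = b PI /\
    forall t, - PI <= t <= PI ->
      V (a t) /\ V (b t) /\ close2 (f x) (a t) d /\ close2 (f x) (b t) d /\
      a t <> f x /\ b t <> f x /\
      F1 (g (a t)) = (rho * cos t, rho * sin t) /\
      F2 (g (a t)) = (rho * cos t, - (rho * sin t)) /\
      F1 (g (b t)) = (rho * cos t, rho * sin t) /\
      F2 (g (b t)) = (rho * cos t, - (rho * Rabs (sin t)))).
  { intros d Hd; destruct (Cf x Ux d Hd) as [d2 [Hd2 Hf2]].
    destruct (Hloops (Rmin dU d2)) as [rho [a [b [Hrho [Ca [Cb [Ha [Hb Hab]]]]]]]];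
      [apply Rmin_glb_lt; auto|].
    assert (HUa : forall t, - PI <= t <= PI -> U (a t)).
    { intros t Ht; apply HU1; [apply Hab, Ht|].
      eapply closeN_mono; [apply Hab, Ht|apply Rmin_l]. }
    assert (HUb : forall t, - PI <= t <= PI -> U (b t)).
    { intros t Ht; apply HU1; [apply Hab, Ht|].
      eapply closeN_mono; [apply Hab, Ht|apply Rmin_l]. }
    exists rho, (fun t => f (a t)), (fun t => f (b t)).
    split; [exact Hrho|]; split; [|split; [|split; [|split]]].
    - apply (cont_comp closeR (closeN N) close2 _ U a f); auto.
    - apply (cont_comp closeR (closeN N) close2 _ U b f); auto.
    - rewrite Ha; reflexivity.
    - rewrite Hb; reflexivity.
    - intros t Ht; specialize (HUa t Ht); specialize (HUb t Ht).
      destruct (Hab t Ht) as [_ [_ [H1 [H2 [H3 [H4 H5]]]]]].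
      rewrite !gf by auto.
      split; [auto|]; split; [auto|]; split; [|split; [|split; [|split; [|exact H5]]]].
      + apply Hf2; auto; eapply closeN_mono; [exact H1|apply Rmin_r].
      + apply Hf2; auto; eapply closeN_mono; [exact H2|apply Rmin_r].
      + intros E; apply H3; rewrite <- (gf (a t)), <- (gf x), E; auto.
      + intros E; apply H4; rewrite <- (gf (b t)), <- (gf x), E; auto. }
  (* If [f x] is on the edge of the half-plane, loop [a] alone contradicts the half-disc lemma;
     otherwise [f x] is interior and degrees are compared. *)
  destruct (Req_dec (snd (f x)) 0) as [Hs|Hs].
  - set (d := Rmin dV d1).
    assert (Hd : 0 < d) by (apply Rmin_glb_lt; auto).
    assert (HdV1 : forall q, half_disc (f x) d q -> V q).
    { intros q [Hq1 Hq2]; apply HV1; auto; eapply close2_mono; [exact Hq2|apply Rmin_l]. }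
    destruct (Hloops' d Hd) as [rho [a [b [Hrho [Ca [_ [Ha [_ Hab]]]]]]]].
    apply (half_disc_loop_null (f x) d rho (fun q => F1 (g q)) a); auto.
    + apply (cont_sub _ _ V); auto.
    + intros q Hq Hqx; apply Hne; auto; eapply close2_mono; [apply Hq|apply Rmin_r].
    + intros t Ht; destruct (Hab t Ht) as [H1 [_ [H2 [_ [H3 _]]]]]; split; [split|]; auto.
    + intros t Ht; apply Hab, Ht.
  - assert (Hs' : 0 < snd (f x)) by (assert (H := VH _ (fV x Ux)); unfold half_plane in H; lra).
    (* The bound by [snd (f x)] keeps the square around [f x] inside the half-plane, so that it is a
       full planar neighbourhood. *)
    set (e := Rmin (Rmin dV d1) (snd (f x))).
    assert (He : 0 < e) by (apply Rmin_glb_lt; auto; apply Rmin_glb_lt; auto).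
    assert (HeV : forall q, close2 (f x) q e -> V q).
    { intros q Hq; apply HV1.
      - unfold half_plane; destruct Hq as [_ Hq]; apply Rabs_def2 in Hq.
        pose proof (Rmin_r (Rmin dV d1) (snd (f x))); unfold e in *; lra.
      - eapply close2_mono; [exact Hq|]; unfold e.
        eapply Rle_trans; [apply Rmin_l|apply Rmin_l]. }
    assert (Hed1 : e <= d1) by (eapply Rle_trans; [apply Rmin_l|apply Rmin_r]).
    assert (Hdeg : forall F, F = F1 \/ F = F2 -> exists k : Z, _) by
      (intros F HF12; apply (punctured_disc_degree (f x) e (fun q => F (g q)) He);
       [apply (cont_sub _ _ V); auto|intros q Hq Hqx; apply Hne; auto;
        eapply close2_mono; [exact Hq|exact Hed1]]).
    destruct (Hdeg F1 (or_introl eq_refl)) as [k1 Hk1].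
    destruct (Hdeg F2 (or_intror eq_refl)) as [k2 Hk2]; clear Hdeg.
    destruct (Hloops' (e / 2)) as [rho [a [b [Hrho [Ca [Cb [Ha [Hb Hab]]]]]]]]; [lra|].
    assert (Hlift : forall z, cont closeR close2 (Icc (- PI) PI) z -> z (- PI) = z PI ->
      (forall t, - PI <= t <= PI -> z t <> f x) ->
      exists al (m : Z), cont closeR closeR (Icc (- PI) PI) al /\
        (forall t, - PI <= t <= PI ->
           angle (fst (z t) - fst (f x), snd (z t) - snd (f x)) (al t)) /\
        al PI - al (- PI) = 2 * PI * IZR m).
    { intros z Cz Hcl Hz.
      destruct (interval_lift (- PI) PI (fun t => (fst (z t) - fst (f x), snd (z t) - snd (f x))))
        as [al [Cal Aal]]; try lra.
      - repeat first [cont_tac | exact Cz].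
      - intros t Ht; apply diff_neq; auto.
      - destruct (angle_unique _ _ _ (Aal PI ltac:(lra))
          ltac:(simpl; rewrite <- Hcl; apply (Aal (- PI)); lra)) as [m Hm].
        exists al, m; auto. }
    destruct (Hlift a) as [al [m [Cal [Aal Hm]]]]; auto; [intros t Ht; apply Hab, Ht|].
    destruct (Hlift b) as [be [l [Cbe [Abe Hl]]]]; auto; [intros t Ht; apply Hab, Ht|].
    assert (Hza : forall t, - PI <= t <= PI -> close2 (f x) (a t) (e / 2) /\ a t <> f x)
      by (intros t Ht; split; apply Hab, Ht).
    assert (Hzb : forall t, - PI <= t <= PI -> close2 (f x) (b t) (e / 2) /\ b t <> f x)
      by (intros t Ht; split; apply Hab, Ht).
    assert (E1 : - PI - - - PI = 2 * PI * IZR k2 * IZR m).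
    { apply (Hk2 a al (fun t => - t) m); auto.
      - apply (cont_ext _ _ _ (fun t => 0 - t)); [intros; ring|repeat cont_tac].
      - intros t Ht; destruct (Hab t Ht) as [_ [_ [_ [_ [_ [_ [_ [E _]]]]]]]].
        rewrite E; exists rho; simpl; rewrite cos_neg, sin_neg.
        split; [exact Hrho|split; ring]. }
    assert (E2 : PI - - PI = 2 * PI * IZR k1 * IZR l).
    { apply (Hk1 b be (fun t => t) l); auto.
      - apply cont_id.
      - intros t Ht; destruct (Hab t Ht) as [_ [_ [_ [_ [_ [_ [_ [_ [E _]]]]]]]]].
        rewrite E; exists rho; auto. }
    (* Under [F2] the loop [b] runs along the lower half-circle and back, so its angle is -|t| and
       its total increment is 0. *)
    assert (E3 : - Rabs PI - - Rabs (- PI) = 2 * PI * IZR k2 * IZR l).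
    { apply (Hk2 b be (fun t => - Rabs t) l); auto.
      - apply (cont_ext _ _ _ (fun t => 0 - Rabs t)); [intros; ring|cont_tac; [cont_tac|]].
        apply (cont_comp1 _ _ Rabs); [cont_tac|intros; apply Rcontinuity_abs].
      - intros t Ht; destruct (Hab t Ht) as [_ [_ [_ [_ [_ [_ [_ [_ [_ E]]]]]]]]].
        rewrite E; exists rho; simpl; rewrite cos_neg, sin_neg.
        assert (Es : cos (Rabs t) = cos t /\ sin (Rabs t) = Rabs (sin t)).
        { unfold Rabs at 1 2; destruct (Rcase_abs t) as [Ht0|Ht0].
          - rewrite cos_neg, sin_neg; split; [reflexivity|].
            rewrite <- sin_neg, <- (Rabs_Ropp (sin t)), <- sin_neg, Rabs_pos_eq; [reflexivity|].
            apply sin_ge_0; lra.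
          - split; [reflexivity|]; rewrite Rabs_pos_eq; [reflexivity|]; apply sin_ge_0; lra. }
        destruct Es as [-> ->]; split; [exact Hrho|split; ring]. }
    rewrite Rabs_Ropp in E3.
    (* The three increments say k2 * m = -1, k1 * l = 1 and k2 * l = 0, and the last forces k2 = 0
       or l = 0. *)
    assert (K2 : IZR k2 * IZR l = 0) by nra.
    destruct (Rmult_integral _ _ K2) as [Z|Z]; rewrite Z in *; lra.
Qed.

(** * Charts of open stars *)

Lemma rsum_ext (f g : nat -> R) (n : nat) :
  (forall i, (i < n)%nat -> f i = g i) -> rsum f n = rsum g n.
Proof.
  induction n as [|n IH]; simpl; intros H; [reflexivity|].
  rewrite IH, H; auto; intros; apply H; lia.
Qed.

Lemma rsum_plus (f g : nat -> R) (n : nat) : rsum (fun i => f i + g i) n = rsum f n + rsum g n.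
Proof. induction n as [|n IH]; simpl; [ring|rewrite IH; ring]. Qed.

Lemma rsum_zero (f : nat -> R) (n : nat) : (forall i, (i < n)%nat -> f i = 0) -> rsum f n = 0.
Proof.
  induction n as [|n IH]; simpl; intros H; [reflexivity|].
  rewrite IH, H by (auto; intros; apply H; lia); ring.
Qed.

Lemma rsum_swap (f : nat -> nat -> R) (m n : nat) :
  rsum (fun i => rsum (f i) m) n = rsum (fun j => rsum (fun i => f i j) n) m.
Proof.
  induction n as [|n IH]; simpl.
  - symmetry; apply rsum_zero; reflexivity.
  - rewrite IH, rsum_plus; reflexivity.
Qed.

Lemma rsum_delta (a n : nat) (y : R) : (a < n)%nat ->
  rsum (fun i => if (i =? a)%nat then y else 0) n = y.
Proof.
  induction n as [|n IH]; intros H; [lia|]; simpl.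
  destruct (Nat.eqb_spec n a) as [->|Hna].
  - rewrite rsum_zero; [ring|]; intros i Hi; destruct (Nat.eqb_spec i a); [lia|reflexivity].
  - rewrite IH by lia; ring.
Qed.

Lemma rsum_pos_exists (f : nat -> R) (n : nat) :
  (forall i, (i < n)%nat -> 0 <= f i) -> 0 < rsum f n -> exists i, (i < n)%nat /\ 0 < f i.
Proof.
  intros H; induction n as [|n IH]; simpl; intros Hs; [lra|].
  destruct (Rle_lt_dec (f n) 0) as [Hn|Hn]; [|exists n; split; [lia|exact Hn]].
  destruct IH as [i [Hi Hi']]; [intros; apply H; lia|lra|exists i; split; [lia|exact Hi']].
Qed.

Lemma rsum_close (f g : nat -> R) (n : nat) (e : R) :
  (forall i, (i < n)%nat -> Rabs (f i - g i) < e) -> Rabs (rsum f n - rsum g n) <= INR n * e.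
Proof.
  induction n as [|n IH]; intros H.
  - simpl; rewrite Rminus_diag, Rabs_R0; lra.
  - rewrite S_INR; simpl.
    assert (H1 : Rabs (f n - g n) < e) by (apply H; lia).
    assert (H2 := IH ltac:(intros; apply H; lia)).
    replace (rsum f n + f n - (rsum g n + g n)) with ((rsum f n - rsum g n) + (f n - g n)) by ring.
    eapply Rle_trans; [apply Rabs_triang|lra].
Qed.

(* [spread v w d c] has barycentric coordinates [c i] at [w i], the rest at [v]. *)
Definition spread (v : nat) (w : nat -> nat) (d : nat) (c : nat -> R) : pt := fun u =>
  if (u =? v)%nat then 1 - rsum c d
  else rsum (fun i => if (u =? w i)%nat then c i else 0) d.

Definition inj_star (N v : nat) (w : nat -> nat) (d : nat) : Prop :=
  (v < N)%nat /\ (forall i, (i < d)%nat -> (w i < N)%nat /\ w i <> v) /\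
  (forall i j, (i < d)%nat -> (j < d)%nat -> w i = w j -> i = j).

Section Spread.

Variables (N v : nat) (w : nat -> nat) (d : nat).
Hypothesis Hw : inj_star N v w d.

Lemma spread_center (c : nat -> R) : spread v w d c v = 1 - rsum c d.
Proof. unfold spread; rewrite Nat.eqb_refl; reflexivity. Qed.

Lemma spread_at (c : nat -> R) (i : nat) : (i < d)%nat -> spread v w d c (w i) = c i.
Proof.
  intros Hi; destruct Hw as [_ [H1 H2]]; unfold spread.
  destruct (Nat.eqb_spec (w i) v) as [E|_]; [destruct (H1 i Hi); contradiction|].
  rewrite <- (rsum_delta i d (c i) Hi); apply rsum_ext; intros j Hj.
  destruct (Nat.eqb_spec (w i) (w j)) as [E|E], (Nat.eqb_spec j i) as [E'|E']; subst; auto.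
  - exfalso; apply E'; symmetry; auto.
  - contradiction E; reflexivity.
Qed.

Lemma spread_off (c : nat -> R) (u : nat) : u <> v -> (forall i, (i < d)%nat -> u <> w i) ->
  spread v w d c u = 0.
Proof.
  intros Hv Hu; unfold spread; destruct (Nat.eqb_spec u v); [contradiction|].
  apply rsum_zero; intros i Hi; destruct (Nat.eqb_spec u (w i)); [|reflexivity].
  exfalso; apply (Hu i Hi); auto.
Qed.

Lemma spread_cases (u : nat) :
  u = v \/ (exists i, (i < d)%nat /\ u = w i) \/ (u <> v /\ forall i, (i < d)%nat -> u <> w i).
Proof.
  destruct (Nat.eq_dec u v) as [->|Hv]; [auto|right].
  assert (H : forall n, (exists i, (i < n)%nat /\ u = w i) \/ (forall i, (i < n)%nat -> u <> w i)).
  { induction n as [|n [[i [Hi E]]|IH]]; [right; intros; lia|left; exists i; split; [lia|auto]|].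
    destruct (Nat.eq_dec u (w n)) as [E|E]; [left; exists n; split; [lia|auto]|].
    right; intros i Hi; destruct (Nat.eq_dec i n) as [->|]; [auto|apply IH; lia]. }
  destruct (H d); auto.
Qed.

Lemma spread_sum (c : nat -> R) : rsum (spread v w d c) N = 1.
Proof.
  destruct Hw as [Hv [H1 H2]].
  rewrite (rsum_ext _ (fun u => (if (u =? v)%nat then 1 - rsum c d else 0) +
                    rsum (fun i => if (u =? w i)%nat then c i else 0) d)).
  - rewrite rsum_plus, rsum_delta, rsum_swap by exact Hv.
    enough (Es : rsum (fun j => rsum (fun i => if (i =? w j)%nat then c j else 0) N) d = rsum c d)
      by (rewrite Es; ring).
    apply rsum_ext; intros j Hj; apply rsum_delta, H1, Hj.
  - intros u _; unfold spread; destruct (Nat.eqb_spec u v) as [->|]; [|ring].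
    rewrite (rsum_zero (fun i => if (v =? w i)%nat then c i else 0) d); [ring|]; intros i Hi.
    destruct (Nat.eqb_spec v (w i)); [|reflexivity]; destruct (H1 i Hi); congruence.
Qed.

Lemma spread_coords (x : pt) : rsum x N = 1 ->
  (forall u, u <> v -> (forall i, (i < d)%nat -> u <> w i) -> x u = 0) ->
  x = spread v w d (fun i => x (w i)).
Proof.
  intros Hs Hx.
  assert (E : rsum x N = x v + rsum (fun i => x (w i)) d).
  { assert (H : x = fun u => (if (u =? v)%nat then x v - 1 + rsum (fun i => x (w i)) d else 0) +
                    spread v w d (fun i => x (w i)) u).
    { apply functional_extensionality; intros u.
      destruct (spread_cases u) as [->|[[i [Hi ->]]|[Hv Hu]]].
      - rewrite spread_center, Nat.eqb_refl; ring.
      - rewrite (spread_at _ i Hi); destruct (Nat.eqb_spec (w i) v) as [E|]; [|ring].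
        destruct Hw as [_ [H1 _]]; destruct (H1 i Hi); contradiction.
      - rewrite spread_off, Hx by auto; destruct (Nat.eqb_spec u v); [contradiction|ring]. }
    transitivity (rsum (fun u => (if (u =? v)%nat then x v - 1 + rsum (fun i => x (w i)) d else 0) +
                    spread v w d (fun i => x (w i)) u) N); [f_equal; exact H|].
    rewrite rsum_plus, rsum_delta, spread_sum by apply Hw; ring. }
  apply functional_extensionality; intros u.
  destruct (spread_cases u) as [->|[[i [Hi ->]]|[Hv Hu]]].
  - rewrite spread_center; lra.
  - rewrite (spread_at _ i Hi); reflexivity.
  - rewrite spread_off, Hx; auto.
Qed.

(** The coordinate at [v] accumulates the errors of the [d] others, whence the factor. *)
Lemma spread_close (c c' : nat -> R) (e : R) : 0 < e ->
  (forall i, (i < d)%nat -> Rabs (c i - c' i) < e) ->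
  closeN N (spread v w d c) (spread v w d c') ((INR d + 1) * e).
Proof.
  intros He H u _; pose proof (pos_INR d).
  destruct (spread_cases u) as [->|[[i [Hi ->]]|[Hv Hu]]].
  - rewrite !spread_center.
    replace (1 - rsum c d - (1 - rsum c' d)) with (- (rsum c d - rsum c' d)) by ring.
    rewrite Rabs_Ropp; eapply Rle_lt_trans; [apply rsum_close, H|lra].
  - rewrite !(spread_at _ i Hi); specialize (H i Hi); nra.
  - rewrite !spread_off by auto; rewrite Rminus_diag, Rabs_R0; nra.
Qed.

End Spread.

(** The infinite cone over the graph with edges [E], its apex being [c = 0]; the open star is the
    part with coordinate sum below 1. *)
Definition cone (d : nat) (E : list (nat * nat)) (c : nat -> R) : Prop :=
  (forall i, (i < d)%nat -> 0 <= c i) /\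
  exists i j, In (i, j) E /\ forall l, (l < d)%nat -> l <> i -> l <> j -> c l = 0.

(* [E] lists the edges of the link of [v], as pairs of indices into the link vertices [w]. *)
Definition link_of (N n1 n2 n3 v : nat) (w : nat -> nat) (d : nat) (E : list (nat * nat)) : Prop :=
  inj_star N v w d /\
  (forall S, is_simplex N n1 n2 n3 S -> S v -> exists i j, In (i, j) E /\
     forall u, S u -> u = v \/ u = w i \/ u = w j) /\
  (forall i j, In (i, j) E -> (i < d)%nat /\ (j < d)%nat /\
     exists S, is_simplex N n1 n2 n3 S /\ S v /\ S (w i) /\ S (w j)).

(** A Lipschitz identification, in both directions, of the infinite cone with [H]. It depends only
    on the shape of the link, so one chart serves all vertices and all N. Values at indices from [d]
    on are junk, so functions are compared index by index. *)
Record cone_chart (d : nat) (E : list (nat * nat)) (H : R * R -> Prop)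
  (phi : (nat -> R) -> R * R) (psi : R * R -> nat -> R) (K : R) : Prop := {
  cc_K : 0 < K;
  cc_ext : forall c c', (forall i, (i < d)%nat -> c i = c' i) -> phi c = phi c';
  cc_phi_lip : forall c c' e, (forall i, (i < d)%nat -> Rabs (c i - c' i) < e) ->
    close2 (phi c) (phi c') (K * e);
  cc_psi_lip : forall p q e, close2 p q e ->
    forall i, (i < d)%nat -> Rabs (psi p i - psi q i) < K * e;
  cc_phi_in : forall c, cone d E c -> H (phi c);
  cc_psi_in : forall p, H p -> cone d E (psi p);
  cc_psi_phi : forall c, cone d E c -> forall i, (i < d)%nat -> psi (phi c) i = c i;
  cc_phi_psi : forall p, H p -> phi (psi p) = p }.

Definition open_star (N n1 n2 n3 v : nat) (x : pt) : Prop :=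
  realization N n1 n2 n3 x /\ 0 < x v.

Lemma open_star_open (N n1 n2 n3 v : nat) : (v < N)%nat ->
  openN N (realization N n1 n2 n3) (open_star N n1 n2 n3 v).
Proof.
  intros Hv; split; [intros x Hx; apply Hx|].
  intros x [Hx Hxv]; exists (x v); split; [exact Hxv|]; intros y Hy Hxy.
  split; [exact Hy|]; specialize (Hxy v Hv); apply Rabs_def2 in Hxy; lra.
Qed.

Section StarChart.

Variables (N n1 n2 n3 v : nat) (w : nat -> nat) (d : nat) (E : list (nat * nat)).
Hypothesis HL : link_of N n1 n2 n3 v w d E.

Lemma open_star_cone (x : pt) : open_star N n1 n2 n3 v x ->
  cone d E (fun i => x (w i)) /\ rsum (fun i => x (w i)) d < 1 /\
  x = spread v w d (fun i => x (w i)).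
Proof.
  destruct HL as [Hw [H1 H2]].
  intros [[Hx0 [HxN [Hs [S [HS Hsup]]]]] Hv].
  destruct (H1 S HS (Hsup v ltac:(lra))) as [i [j [Hij HSij]]].
  destruct (H2 i j Hij) as [Hi [Hj _]].
  assert (Hx : x = spread v w d (fun i => x (w i))).
  { apply (spread_coords N); auto; intros u Hu Hu'.
    destruct (Req_dec (x u) 0) as [Hz|Hz]; [exact Hz|].
    destruct (HSij u (Hsup u Hz)) as [-> | [-> | ->]]; [contradiction|exfalso..].
    - exact (Hu' i Hi eq_refl).
    - exact (Hu' j Hj eq_refl). }
  split; [split|split; [|exact Hx]].
  - intros l Hl; apply Hx0, Hw, Hl.
  - exists i, j; split; [exact Hij|]; intros l Hl Hli Hlj.
    destruct (Req_dec (x (w l)) 0) as [Hz|Hz]; [exact Hz|].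
    destruct Hw as [_ [Hw1 Hw2]].
    destruct (HSij _ (Hsup _ Hz)) as [Q|[Q|Q]].
    + destruct (Hw1 l Hl); contradiction.
    + contradiction Hli; auto.
    + contradiction Hlj; auto.
  - rewrite Hx, spread_center in Hv; lra.
Qed.

Lemma spread_open_star (c : nat -> R) : cone d E c -> rsum c d < 1 ->
  open_star N n1 n2 n3 v (spread v w d c).
Proof.
  destruct HL as [Hw [H1 H2]].
  intros [Hc [i [j [Hij Hz]]]] Hs; split; [|rewrite spread_center; lra].
  destruct (H2 i j Hij) as [Hi [Hj [S [HS [HSv [HSi HSj]]]]]].
  split; [|split; [|split]].
  - intros u _; destruct (spread_cases v w d u) as [->|[[l [Hl ->]]|[Hv Hu]]].
    + rewrite spread_center; lra.
    + rewrite (spread_at N) by auto; auto.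
    + rewrite spread_off by auto; lra.
  - intros u Hu; destruct Hw as [Hv [Hw1 _]]; apply spread_off; [lia|].
    intros l Hl; specialize (Hw1 l Hl); lia.
  - apply spread_sum, Hw.
  - exists S; split; [exact HS|]; intros u Hu.
    destruct (spread_cases v w d u) as [->|[[l [Hl ->]]|[Hv Hu']]]; [exact HSv| |].
    + rewrite (spread_at N) in Hu by auto.
      destruct (Nat.eq_dec l i) as [->|Hli]; [exact HSi|].
      destruct (Nat.eq_dec l j) as [->|Hlj]; [exact HSj|].
      contradiction Hu; auto.
    + contradiction Hu; apply spread_off; auto.
Qed.

Variables (H : R * R -> Prop) (phi : (nat -> R) -> R * R) (psi : R * R -> nat -> R) (K : R).
Hypothesis HC : cone_chart d E H phi psi K.

Definition star_image (p : R * R) : Prop := H p /\ rsum (psi p) d < 1.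

Lemma star_image_open : open2 H star_image.
Proof.
  split; [intros p Hp; apply Hp|]; intros p [Hp Hs].
  pose proof (cc_K _ _ _ _ _ _ HC) as HK; pose proof (pos_INR d) as Hd.
  (* Within this distance each of the [d] coordinates moves by at most (1 - sum) / (d + 1), so their
     sum stays below 1. *)
  exists ((1 - rsum (psi p) d) / ((INR d + 1) * K)).
  assert (He : 0 < (1 - rsum (psi p) d) / ((INR d + 1) * K)) by (apply Rdiv_lt_0_compat; nra).
  split; [exact He|]; intros q Hq Hpq; split; [exact Hq|].
  assert (HB := rsum_close (psi p) (psi q) d _ (cc_psi_lip _ _ _ _ _ _ HC p q _ Hpq)).
  replace (INR d * (K * ((1 - rsum (psi p) d) / ((INR d + 1) * K)))) with
    ((1 - rsum (psi p) d) * (INR d / (INR d + 1))) in HB by (field; lra).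
  assert (Hlt : INR d / (INR d + 1) < 1).
  { apply (Rmult_lt_reg_r (INR d + 1)); [lra|]; field_simplify; lra. }
  apply Rabs_le_between in HB; nra.
Qed.

Lemma star_homeo : homeo N (open_star N n1 n2 n3 v) star_image
  (fun x => phi (fun i => x (w i))) (fun p => spread v w d (psi p)).
Proof.
  pose proof (proj1 HL) as Hw; destruct HC as [HK Hext Hphi Hpsi Hin Hin' Hpp Hpp'].
  pose proof (pos_INR d) as Hd.
  split; [|split; [|split; [|split; [|split]]]].
  - intros x Hx; destruct (open_star_cone x Hx) as [Hc [Hlt _]]; split; [auto|].
    rewrite (rsum_ext _ (fun i => x (w i))); [exact Hlt|exact (Hpp _ Hc)].
  - intros p [Hp Hs]; apply spread_open_star; auto.
  - intros x Hx; destruct (open_star_cone x Hx) as [Hc [Hs Hx']].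
    transitivity (spread v w d (fun i => x (w i))); [|symmetry; exact Hx'].
    unfold spread; apply functional_extensionality; intros u.
    rewrite (rsum_ext (psi _) (fun i => x (w i))) by exact (Hpp _ Hc).
    destruct (u =? v)%nat; [reflexivity|]; apply rsum_ext; intros i Hi.
    rewrite (Hpp _ Hc i Hi); reflexivity.
  - intros p [Hp Hs]; transitivity (phi (psi p)); [|apply Hpp', Hp].
    apply Hext; intros i Hi; apply (spread_at N); auto.
  - apply (cont_lipschitz _ _ _ _ K HK); intros x y e _ _ _ Hxy.
    apply Hphi; intros i Hi; apply Hxy, Hw, Hi.
  - apply (cont_lipschitz _ _ _ _ ((INR d + 1) * K)); [nra|]; intros p q e _ _ He Hpq.
    rewrite Rmult_assoc; apply spread_close; [exact Hw|nra|]; apply Hpsi, Hpq.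
Qed.

Lemma star_chart : homeomorphic N (open_star N n1 n2 n3 v) star_image.
Proof. eexists; eexists; apply star_homeo. Qed.

End StarChart.

Lemma realization_vertex_pos (N n1 n2 n3 : nat) (x : pt) : realization N n1 n2 n3 x ->
  exists v, (v < N)%nat /\ open_star N n1 n2 n3 v x.
Proof.
  intros Hx; destruct (rsum_pos_exists x N) as [v [Hv Hxv]].
  - apply Hx.
  - destruct Hx as [_ [_ [-> _]]]; lra.
  - exists v; split; [exact Hv|split; auto].
Qed.

Lemma open_star_charts (N n1 n2 n3 d : nat) (E : list (nat * nat)) (w : nat -> nat -> nat)
  (H : R * R -> Prop) (phi : (nat -> R) -> R * R) (psi : R * R -> nat -> R) (K : R) :
  (forall v, (v < N)%nat -> link_of N n1 n2 n3 v (w v) d E) -> cone_chart d E H phi psi K ->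
  forall x, realization N n1 n2 n3 x -> exists U V,
    openN N (realization N n1 n2 n3) U /\ U x /\ open2 H V /\ homeomorphic N U V.
Proof.
  intros HL HC x Hx; destruct (realization_vertex_pos _ _ _ _ _ Hx) as [v [Hv Hxv]].
  exists (open_star N n1 n2 n3 v), (star_image d H psi).
  split; [apply open_star_open, Hv|]; split; [exact Hxv|]; split.
  - exact (star_image_open _ _ _ _ _ _ HC).
  - apply (star_chart _ _ _ _ _ (w v) d E (HL v Hv) H phi psi K HC).
Qed.

(** The boundary point is vertex 0 itself: it is the apex of its cone, which the chart sends to the
    edge of the half-plane. *)
Lemma surface_with_boundary_of_half_plane_charts (N n1 n2 n3 d : nat) (E : list (nat * nat))
  (w : nat -> nat -> nat) (phi : (nat -> R) -> R * R) (psi : R * R -> nat -> R) (K : R) :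
  (0 < N)%nat ->
  (forall v, (v < N)%nat -> link_of N n1 n2 n3 v (w v) d E) ->
  cone_chart d E half_plane phi psi K -> E <> nil -> snd (phi (fun _ => 0)) = 0 ->
  is_surface_with_boundary N (realization N n1 n2 n3) /\
  exists x, is_boundary_point N (realization N n1 n2 n3) x.
Proof.
  intros HN HL HC HE Hphi; split; [exact (open_star_charts _ _ _ _ _ _ _ _ _ _ _ HL HC)|].
  exists (spread 0 (w 0%nat) d (fun _ => 0)).
  apply (half_plane_chart_boundary N _ (open_star N n1 n2 n3 0) (star_image d half_plane psi)
    (fun x => phi (fun i => x (w 0%nat i))) (fun p => spread 0 (w 0%nat) d (psi p))).
  - apply open_star_open, HN.
  - apply (spread_open_star _ _ _ _ _ _ _ _ (HL 0%nat HN)).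
    + split; [intros; lra|].
      destruct E as [|[i j] E']; [contradiction HE; reflexivity|].
      exists i, j; split; [left; reflexivity|auto].
    + rewrite rsum_zero by auto; lra.
  - exact (star_image_open _ _ _ _ _ _ HC).
  - apply (star_homeo _ _ _ _ _ (w 0%nat) d E (HL 0%nat HN) half_plane phi psi K HC).
  - transitivity (snd (phi (fun _ => 0))); [|exact Hphi].
    f_equal; apply (cc_ext _ _ _ _ _ _ HC); intros i Hi.
    apply (spread_at N 0 (w 0%nat) d); auto; apply HL, HN.
Qed.

(** * Flattening the cones over the links *)

Ltac small_index i Hi :=
  destruct i as [|i]; [clear Hi | first [exfalso; lia | small_index i Hi]].

Ltac split_minmax := unfold Rmax, Rmin in *; repeat destruct Rle_dec.

Ltac expand_small d H :=
  match d with
  | O => idtac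
  | S ?n => expand_small n H; pose proof (H n ltac:(lia))
  end.

Ltac pick_edge E :=
  match E with
  | nil => fail
  | cons (?i, ?j) ?E' =>
      first [ exists i, j; split; [simpl; tauto|];
              let l := fresh "l" in let Hl := fresh "Hl" in
              intros l Hl ? ?; small_index l Hl; try lia; simpl; split_minmax; lra
            | pick_edge E' ]
  end.

Ltac cone_cases d Hc :=
  let i := fresh "i" in let j := fresh "j" in let Hij := fresh "Hij" in let Hz := fresh "Hz" in
  let H0 := fresh "H0" in
  destruct Hc as [H0 [i [j [Hij Hz]]]]; expand_small d H0; clear H0; simpl in Hij;
  repeat match goal with H : _ \/ _ |- _ => destruct H as [H|H] end;
  try contradiction; injection Hij as <- <-; expand_small d Hz; clear Hz;
  repeat match goal with
  | H : ?a <> ?a -> _ |- _ => clear H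
  | H : _ -> ?a <> ?a -> _ |- _ => clear H
  | H : ?a <> ?b -> _ |- _ => specialize (H ltac:(discriminate))
  end.

Ltac chart_tac d :=
  split; [lra|..];
  [ intros c c' H; expand_small d H; simpl; congruence
  | intros c c' e H; expand_small d H; clear H;
    repeat match goal with H : Rabs _ < _ |- _ => apply Rabs_def2 in H end;
    split; simpl; apply Rabs_def1; split_minmax; lra
  | intros p q e [H1 H2] i Hi; apply Rabs_def2 in H1, H2; small_index i Hi; simpl;
    apply Rabs_def1; split_minmax; lra
  | | | | ].

Definition triangle_edges : list (nat * nat) := [(0, 1)]%nat.

(** Opens the quadrant into a half-plane by bending along the diagonal; a linear map would leave its
    angle below PI, hence the [Rmin]. *)
Definition triangle_flat (c : nat -> R) : R * R := (c 0%nat - c 1%nat, Rmin (c 0%nat) (c 1%nat)).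

Definition triangle_coords (p : R * R) (i : nat) : R :=
  match i with
  | O => snd p + Rmax (fst p) 0
  | _ => snd p + Rmax (- fst p) 0
  end.

(** The constant 8 is shared by all the charts; no flattening adds more than four coordinates, so 4
    would already bound the errors. *)
Lemma triangle_chart : cone_chart 2 triangle_edges half_plane triangle_flat triangle_coords 8.
Proof.
  unfold triangle_flat, triangle_coords.
  chart_tac 2%nat.
  - intros c Hc; cone_cases 2%nat Hc; unfold half_plane; simpl; split_minmax; lra.
  - intros p Hp; unfold half_plane in Hp; split.
    + intros i Hi; small_index i Hi; split_minmax; lra.
    + pick_edge [(0, 1)]%nat.
  - intros c Hc i Hi; cone_cases 2%nat Hc; small_index i Hi; simpl; split_minmax; lra.
  - intros [x y] Hp; unfold half_plane in Hp; simpl in *; f_equal; split_minmax; lra.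
Qed.

Definition fan_edges : list (nat * nat) := [(0, 1); (1, 2); (2, 3)]%nat.

(* the link vertices 0, 1, 2, 3 go to (1,0), (1,1), (0,1), (-1,0) *)
Definition fan_flat (c : nat -> R) : R * R :=
  (c 0%nat + c 1%nat - c 3%nat, c 1%nat + c 2%nat).

Definition fan_coords (p : R * R) (i : nat) : R :=
  match i with
  | 0%nat => Rmax 0 (fst p - snd p)
  | 1%nat => Rmax 0 (Rmin (fst p) (snd p))
  | 2%nat => Rmax 0 (Rmin (snd p) (snd p - fst p))
  | _ => Rmax 0 (- fst p)
  end.

Lemma fan_chart : cone_chart 4 fan_edges half_plane fan_flat fan_coords 8.
Proof.
  unfold fan_flat, fan_coords.
  chart_tac 4%nat.
  - intros c Hc; cone_cases 4%nat Hc; unfold half_plane; simpl; lra.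
  - intros [x y] Hp; unfold half_plane in Hp; simpl in Hp; split.
    + intros i Hi; small_index i Hi; simpl; split_minmax; lra.
    + destruct (Rle_dec x 0), (Rle_dec x y); pick_edge [(0, 1); (1, 2); (2, 3)]%nat.
  - intros c Hc i Hi; cone_cases 4%nat Hc; small_index i Hi; simpl; split_minmax; lra.
  - intros [x y] Hp; unfold half_plane in Hp; simpl in *; f_equal; split_minmax; lra.
Qed.

Definition tetrahedron_edges : list (nat * nat) := [(0, 1); (1, 2); (0, 2)]%nat.

(** The cone over a triangle is the boundary of the positive octant; this is its projection along
    (1, 1, 1). The inverse moves back along that direction until the smallest coordinate is 0. *)
Definition tetrahedron_flat (c : nat -> R) : R * R := (c 0%nat - c 2%nat, c 1%nat - c 2%nat).

Definition tetrahedron_coords (p : R * R) (i : nat) : R :=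
  match i with
  | 0%nat => fst p - Rmin 0 (Rmin (fst p) (snd p))
  | 1%nat => snd p - Rmin 0 (Rmin (fst p) (snd p))
  | _ => - Rmin 0 (Rmin (fst p) (snd p))
  end.

Lemma tetrahedron_chart :
  cone_chart 3 tetrahedron_edges plane tetrahedron_flat tetrahedron_coords 8.
Proof.
  unfold tetrahedron_flat, tetrahedron_coords.
  chart_tac 3%nat.
  - intros; exact I.
  - intros [x y] _; split.
    + intros i Hi; small_index i Hi; simpl; split_minmax; lra.
    + destruct (Rle_dec x 0), (Rle_dec y 0), (Rle_dec x y);
        pick_edge [(0, 1); (1, 2); (0, 2)]%nat.
  - intros c Hc i Hi; cone_cases 3%nat Hc; small_index i Hi; simpl; split_minmax; lra.
  - intros [x y] _; simpl; f_equal; ring.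
Qed.

Definition hexagon_edges : list (nat * nat) := [(0, 1); (1, 2); (2, 3); (3, 4); (4, 5); (0, 5)]%nat.

(* the link vertices go to (1,0), (1,1), (0,1), (-1,0), (-1,-1), (0,-1) *)
Definition hexagon_flat (c : nat -> R) : R * R :=
  (c 0%nat + c 1%nat - c 3%nat - c 4%nat, c 1%nat + c 2%nat - c 4%nat - c 5%nat).

Definition hexagon_coords (p : R * R) (i : nat) : R :=
  match i with
  | 0%nat => Rmax 0 (Rmin (fst p) (fst p - snd p))
  | 1%nat => Rmax 0 (Rmin (fst p) (snd p))
  | 2%nat => Rmax 0 (Rmin (snd p) (snd p - fst p))
  | 3%nat => Rmax 0 (Rmin (- fst p) (snd p - fst p))
  | 4%nat => Rmax 0 (Rmin (- fst p) (- snd p))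
  | _ => Rmax 0 (Rmin (- snd p) (fst p - snd p))
  end.

Lemma hexagon_chart : cone_chart 6 hexagon_edges plane hexagon_flat hexagon_coords 8.
Proof.
  unfold hexagon_flat, hexagon_coords.
  chart_tac 6%nat.
  - intros; exact I.
  - intros [x y] _; split.
    + intros i Hi; small_index i Hi; simpl; split_minmax; lra.
    (* The lines x = 0, y = 0 and x = y cut the plane into the six sectors of the hexagon. *)
    + destruct (Rle_dec x 0), (Rle_dec y 0), (Rle_dec x y);
        pick_edge [(0, 1); (1, 2); (2, 3); (3, 4); (4, 5); (0, 5)]%nat.
  - intros c Hc i Hi; cone_cases 6%nat Hc; small_index i Hi; simpl; split_minmax; lra.
  - intros [x y] _; simpl.
    destruct (Rle_dec x 0), (Rle_dec y 0), (Rle_dec x y); f_equal; split_minmax; lra.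
Qed.

(** * Links of the vertices *)

(** Every sum of residues met below is less than 2N, so reduction subtracts N at most once and all
    incidences become linear arithmetic. *)
Lemma mod_lt_double (a N : nat) : (a < 2 * N)%nat ->
  ((a < N)%nat /\ (a mod N)%nat = a) \/ ((N <= a)%nat /\ (a mod N + N)%nat = a).
Proof.
  intros H; destruct (Nat.lt_ge_cases a N) as [Ha|Ha].
  - left; split; [exact Ha|apply Nat.mod_small, Ha].
  - right; split; [exact Ha|].
    replace a with ((a - N) + 1 * N)%nat at 1 by lia.
    rewrite Nat.Div0.mod_add, Nat.mod_small; lia.
Qed.

Ltac elim_mod :=
  repeat match goal with
  | |- context [(?a mod ?N)%nat] =>
      let m := fresh "m" in
      destruct (mod_lt_double a N ltac:(lia)); set (m := (a mod N)%nat) in *; clearbody m;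
      try (exfalso; lia)
  | H : context [(?a mod ?N)%nat] |- _ =>
      let m := fresh "m" in
      destruct (mod_lt_double a N ltac:(lia)); set (m := (a mod N)%nat) in *; clearbody m;
      try (exfalso; lia)
  end.

Ltac link_edge HS E :=
  match E with
  | cons (?i, ?j) ?E' =>
      first [ exists i, j; split; [simpl; tauto|];
              let u := fresh "u" in let Hu := fresh "Hu" in
              intros u Hu; apply HS in Hu; simpl; unfold tri_plus, tri_minus, edge in Hu;
              elim_mod; lia
            | link_edge HS E' ]
  end.

(** The six candidates place [v] in each of the three positions of a triangle of each
    orientation. *)
Ltac link_simplex N n1 n2 v :=
  let go T k := (exists (T N n1 n2 k); split;
    [exists k; split; [elim_mod; lia|tauto]|unfold tri_plus, tri_minus; simpl; elim_mod; lia]) in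
  first [ go tri_plus v | go tri_plus ((v + (N - n1)) mod N)%nat
        | go tri_plus ((v + (N - (n1 + n2))) mod N)%nat
        | go tri_minus v | go tri_minus ((v + n1) mod N)%nat
        | go tri_minus ((v + (n1 + n2)) mod N)%nat ].

Ltac link_tac N n1 n2 v E :=
  split; [split; [lia|split] | split];
  [ intros i Hi; small_index i Hi; simpl; elim_mod; lia
  | intros i j Hi Hj; small_index i Hi; small_index j Hj; simpl; try reflexivity; elim_mod; lia
  | intros S [k [Hk [HS|[HS|[HS|[HS|[HS|HS]]]]]]] Sv; apply HS in Sv;
    unfold tri_plus, tri_minus, edge in Sv;
    repeat match goal with H : v = _ \/ _ |- _ => destruct H as [H|H] end;
    link_edge HS E
  | intros i j Hij; simpl in Hij;
    repeat match goal with H : _ \/ _ |- _ => destruct H as [H|H] end;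
    try contradiction; injection Hij as <- <-; (split; [lia|split; [lia|]]);
    link_simplex N n1 n2 v ].

Definition triangle_link (N m v i : nat) : nat :=
  ((v + match i with O => m | _ => 2 * m end) mod N)%nat.

(** All triangles through [v] coincide with {v, v+m, v+2m}. *)
Lemma link_equal (N m v : nat) : (0 < m)%nat -> N = (3 * m)%nat -> (v < N)%nat ->
  link_of N m m m v (triangle_link N m v) 2 triangle_edges.
Proof.
  intros Hm HN Hv; unfold triangle_link, triangle_edges.
  link_tac N m m v [(0, 1)]%nat.
Qed.

Definition fan_link (N m v i : nat) : nat :=
  ((v + match i with 0 => 2 * m | 1 => m | 2 => N - m | _ => N - 2 * m end) mod N)%nat.

(** The triangles are the progressions {k, k+m, k+2m}. The three through [v] form the path v+2m,
    v+m, v-m, v-2m in the link, whose ends would coincide exactly when N = 4m, that is, 2n = N. *)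
Lemma link_fan_small (N m n v : nat) : (0 < m < n)%nat -> N = (2 * m + n)%nat ->
  (2 * n)%nat <> N -> (v < N)%nat -> link_of N m m n v (fan_link N m v) 4 fan_edges.
Proof.
  intros Hm HN Hn Hv; unfold fan_link, fan_edges.
  link_tac N m m v [(0, 1); (1, 2); (2, 3)]%nat.
Qed.

(** As n = -2m modulo N, the triangles are again progressions with step m, and the same fan
    appears. *)
Lemma link_fan_large (N n m v : nat) : (0 < n < m)%nat -> N = (n + 2 * m)%nat ->
  (v < N)%nat -> link_of N n m m v (fan_link N m v) 4 fan_edges.
Proof.
  intros Hm HN Hv; unfold fan_link, fan_edges.
  link_tac N n m v [(0, 1); (1, 2); (2, 3)]%nat.
Qed.

Definition tetrahedron_link (N m v i : nat) : nat :=
  ((v + match i with 0 => m | 1 => 2 * m | _ => 3 * m end) mod N)%nat.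

(** Here the multiples of m behave like Z/4 with all its 3-subsets as triangles: each coset spans
    the boundary of a tetrahedron. *)
Lemma link_tetrahedron (N m n v : nat) : (0 < m)%nat -> n = (2 * m)%nat -> N = (4 * m)%nat ->
  (v < N)%nat -> link_of N m m n v (tetrahedron_link N m v) 3 tetrahedron_edges.
Proof.
  intros Hm Hn HN Hv; unfold tetrahedron_link, tetrahedron_edges.
  link_tac N m m v [(0, 1); (1, 2); (0, 2)]%nat.
Qed.

Definition hexagon_link (N n1 n2 n3 v i : nat) : nat :=
  ((v + match i with
        | 0 => n1 | 1 => N - n3 | 2 => n2 | 3 => N - n1 | 4 => n3 | _ => N - n2
        end) mod N)%nat.

(** The neighbours are v + n_i and v - n_i. In the cyclic order n1, -n3, n2, -n1, n3, -n2,
    consecutive ones differ by plus or minus the third parameter. Under these inequalities they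
    could only collide as n3 = -n3, which [2 * n3 <> N] excludes. *)
Lemma link_hexagon (N n1 n2 n3 v : nat) : (0 < n1 < n2)%nat -> (n2 < n3)%nat ->
  N = (n1 + n2 + n3)%nat -> (2 * n3)%nat <> N -> (v < N)%nat ->
  link_of N n1 n2 n3 v (hexagon_link N n1 n2 n3 v) 6 hexagon_edges.
Proof.
  intros H1 H2 HN Hn Hv; unfold hexagon_link, hexagon_edges.
  link_tac N n1 n2 v [(0, 1); (1, 2); (2, 3); (3, 4); (4, 5); (0, 5)]%nat.
Qed.

Definition book_edges : list (nat * nat) := [(0, 1); (0, 2); (0, 3); (0, 4); (1, 4); (2, 3)]%nat.

(* When n3 = N/2 the edge {0, n3} lies in four triangles, with third vertices [book_link i] for
   i = 1, 2, 3, 4. *)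
Definition book_link (n1 n2 n3 i : nat) : nat :=
  match i with
  | 0 => n3 | 1 => n1 | 2 => n2 | 3 => n3 + n3 - n1 | _ => n3 + n3 - n2
  end%nat.

Lemma link_book (N n1 n2 n3 : nat) : (0 < n1 < n2)%nat -> n3 = (n1 + n2)%nat ->
  N = (2 * n3)%nat -> link_of N n1 n2 n3 0 (book_link n1 n2 n3) 5 book_edges.
Proof.
  intros H1 H2 HN; unfold book_link, book_edges.
  link_tac N n1 n2 0%nat [(0, 1); (0, 2); (0, 3); (0, 4); (1, 4); (2, 3)]%nat.
Qed.

(** * The book along the edge {0, N/2} *)

Lemma cont_spread {A : Type} (dA : A -> A -> R -> Prop) (D : A -> Prop) (N v : nat)
  (w : nat -> nat) (d : nat) (c : A -> nat -> R) :
  (forall x y e e', dA x y e -> e <= e' -> dA x y e') -> inj_star N v w d ->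
  (forall i, (i < d)%nat -> cont dA closeR D (fun x => c x i)) ->
  cont dA (closeN N) D (fun x => spread v w d (c x)).
Proof.
  intros Hm Hw Hc x Hx e He.
  pose proof (pos_INR d) as Hd.
  set (e' := e / (INR d + 1)).
  assert (He' : 0 < e') by (apply Rdiv_lt_0_compat; lra).
  assert (H : forall n, (n <= d)%nat -> exists r, 0 < r /\ forall y, D y -> dA x y r ->
    forall i, (i < n)%nat -> Rabs (c x i - c y i) < e').
  { induction n as [|n IH]; intros Hn; [exists 1; split; [lra|]; intros; lia|].
    destruct IH as [r1 [Hr1 H1]]; [lia|].
    destruct (Hc n ltac:(lia) x Hx e' He') as [r2 [Hr2 H2]].
    exists (Rmin r1 r2); split; [apply Rmin_glb_lt; auto|]; intros y Hy Hxy i Hi.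
    destruct (Nat.eq_dec i n) as [->|Hin].
    - apply (H2 y Hy), (Hm _ _ _ _ Hxy (Rmin_r _ _)).
    - apply (H1 y Hy (Hm _ _ _ _ Hxy (Rmin_l _ _))); lia. }
  destruct (H d (le_n d)) as [r [Hr Hr']]; exists r; split; [exact Hr|]; intros y Hy Hxy.
  replace e with ((INR d + 1) * e') by (unfold e'; field; lra).
  apply spread_close; auto.
Qed.

(* The circle of radius [rho] about the midpoint of the spine whose upper half runs in page 1
   and whose lower half runs in page [j]. *)
Definition page_loop (rho : R) (j : nat) (t : R) (i : nat) : R :=
  match i with
  | 0%nat => (1 - rho * Rabs (sin t) - rho * cos t) / 2
  | 1%nat => Rmax 0 (rho * sin t)
  | _ => if (i =? j)%nat then Rmax 0 (- (rho * sin t)) else 0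
  end.

Definition spine_mid (i : nat) : R := match i with O => / 2 | _ => 0 end.

(** The spine goes to the horizontal axis, page 1 to the upper half-plane, and the other three pages
    are folded together onto the lower one. *)
Definition flatten_page1 (w : nat -> nat) (y : pt) : R * R :=
  (y 0%nat - y (w 0%nat), y (w 1%nat) - y (w 2%nat) - y (w 3%nat) - y (w 4%nat)).

Definition flatten_page2 (w : nat -> nat) (y : pt) : R * R :=
  (y 0%nat - y (w 0%nat), y (w 2%nat) - y (w 1%nat) - y (w 3%nat) - y (w 4%nat)).

Lemma cont_coord (N v : nat) (D : pt -> Prop) : (v < N)%nat ->
  cont (closeN N) closeR D (fun y => y v).
Proof. intros Hv x _ e He; exists e; split; [exact He|]; intros y _ Hxy; apply Hxy, Hv. Qed.

Section Book.

Variables (N n1 n2 n3 : nat) (w : nat -> nat).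
Hypothesis HL : link_of N n1 n2 n3 0 w 5 book_edges.

Let X := realization N n1 n2 n3.
Let x := spread 0 w 5 spine_mid.

Lemma flatten_page1_spread (c : nat -> R) : flatten_page1 w (spread 0 w 5 c) =
  (1 - rsum c 5 - c 0%nat, c 1%nat - c 2%nat - c 3%nat - c 4%nat).
Proof.
  unfold flatten_page1; rewrite spread_center.
  rewrite !(spread_at N 0 w 5 (proj1 HL)) by lia; reflexivity.
Qed.

Lemma flatten_page2_spread (c : nat -> R) : flatten_page2 w (spread 0 w 5 c) =
  (1 - rsum c 5 - c 0%nat, c 2%nat - c 1%nat - c 3%nat - c 4%nat).
Proof.
  unfold flatten_page2; rewrite spread_center.
  rewrite !(spread_at N 0 w 5 (proj1 HL)) by lia; reflexivity.
Qed.

(** Both spine coordinates of [x] are 1/2, so within that distance they stay positive. This rules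
    out the link edges (1, 4) and (2, 3), leaving at most one nonzero page coordinate; the vanishing
    signed sum then kills it. *)
Lemma flatten_page_zero (y : pt) : X y -> closeN N x y (/ 2) ->
  flatten_page1 w y = (0, 0) \/ flatten_page2 w y = (0, 0) -> y = x.
Proof.
  intros Hy Hxy HF.
  pose proof (proj1 HL) as Hw; pose proof Hw as [HN [Hw1 _]].
  assert (Hy0 : 0 < y 0%nat).
  { specialize (Hxy 0%nat HN); unfold x in Hxy; rewrite spread_center in Hxy.
    unfold spine_mid in Hxy; simpl in Hxy; apply Rabs_def2 in Hxy; lra. }
  assert (Hyw : 0 < y (w 0%nat)).
  { specialize (Hxy (w 0%nat) ltac:(apply Hw1; lia)); unfold x in Hxy.
    rewrite (spread_at N) in Hxy by (auto; lia).
    simpl in Hxy; apply Rabs_def2 in Hxy; lra. }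
  destruct (open_star_cone _ _ _ _ _ _ _ _ HL y (conj Hy Hy0)) as [Hc [_ Ey]].
  rewrite Ey, flatten_page1_spread, flatten_page2_spread in HF.
  assert (Hz : y (w 0%nat) = / 2 /\ y (w 1%nat) = 0 /\ y (w 2%nat) = 0 /\
               y (w 3%nat) = 0 /\ y (w 4%nat) = 0).
  { unfold book_edges in Hc; simpl in HF.
    assert (HF1 : 1 - (0 + y (w 0%nat) + y (w 1%nat) + y (w 2%nat) + y (w 3%nat) + y (w 4%nat))
                  - y (w 0%nat) = 0) by (destruct HF as [HF|HF]; injection HF; auto).
    assert (HF2 : y (w 1%nat) - y (w 2%nat) - y (w 3%nat) - y (w 4%nat) = 0 \/
                  y (w 2%nat) - y (w 1%nat) - y (w 3%nat) - y (w 4%nat) = 0)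
      by (destruct HF as [HF|HF]; injection HF; auto).
    clear - HF1 HF2 Hc Hyw.
    destruct HF2 as [HF2|HF2]; cone_cases 5%nat Hc; lra. }
  rewrite Ey; unfold x, spread; apply functional_extensionality; intros u.
  assert (Hext : forall i, (i < 5)%nat -> y (w i) = spine_mid i)
    by (intros i Hi; unfold spine_mid; small_index i Hi; apply Hz).
  rewrite (rsum_ext (fun i => y (w i)) spine_mid 5 Hext).
  destruct (u =? 0)%nat; [reflexivity|]; apply rsum_ext; intros i Hi.
  rewrite (Hext i Hi); reflexivity.
Qed.

(** The page coordinates total rho |sin t|, and the rest is split between the spine ends so that
    their difference is rho cos t. Each listed coordinate is within 2 rho of the midpoint, and
    [spread_close] with d = 5 multiplies this by 6, giving 12 rho; [rho <= / 8] keeps the spine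
    coordinates positive. *)
Lemma page_loop_props (rho d : R) (j : nat) (t : R) : j = 2%nat \/ j = 3%nat ->
  0 < rho -> rho <= / 8 -> 12 * rho <= d ->
  let y := spread 0 w 5 (page_loop rho j t) in
  X y /\ closeN N x y d /\ y <> x /\ flatten_page1 w y = (rho * cos t, rho * sin t) /\
  flatten_page2 w y = (rho * cos t, - (rho * (if (j =? 2)%nat then sin t else Rabs (sin t)))).
Proof.
  intros Hj Hrho Hrho8 Hd y.
  pose proof (COS_bound t) as Bc; pose proof (SIN_bound t) as Bs.
  assert (Bc' : - rho <= rho * cos t <= rho) by nra.
  assert (Bs' : - rho <= rho * sin t <= rho) by nra.
  assert (Babs : rho * Rabs (sin t) = Rmax 0 (rho * sin t) + Rmax 0 (- (rho * sin t))).
  { unfold Rabs; destruct (Rcase_abs (sin t)); split_minmax; nra. }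
  assert (Hsum : rsum (page_loop rho j t) 5 = (1 + rho * Rabs (sin t) - rho * cos t) / 2).
  { unfold rsum, page_loop; destruct Hj as [-> | ->]; simpl; rewrite Babs; field. }
  assert (E1 : flatten_page1 w y = (rho * cos t, rho * sin t)).
  { unfold y; rewrite flatten_page1_spread, Hsum; f_equal; unfold page_loop.
    - field.
    - destruct Hj as [-> | ->]; simpl; split_minmax; lra. }
  split; [|split; [|split; [|split]]].
  - apply (spread_open_star _ _ _ _ _ _ _ _ HL); [split|].
    + intros i Hi; unfold page_loop; rewrite Babs.
      destruct Hj as [-> | ->]; small_index i Hi; simpl; split_minmax; lra.
    + unfold page_loop; destruct (Rle_dec 0 (sin t)) as [Hs|Hs].
      * exists 0%nat, 1%nat; split; [simpl; tauto|]; intros l Hl Hl0 Hl1.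
        destruct l as [|[|l]]; [lia|lia|].
        destruct (_ =? _)%nat; [|reflexivity]; apply Rmax_left; nra.
      * exists 0%nat, j; split; [destruct Hj as [-> | ->]; simpl; tauto|]; intros l Hl Hl0 Hlj.
        destruct l as [|[|l]]; [lia|apply Rmax_left; nra|].
        destruct (Nat.eqb_spec (S (S l)) j); [contradiction|reflexivity].
    + rewrite Hsum, Babs; split_minmax; lra.
  - apply (closeN_mono _ _ _ ((INR 5 + 1) * (2 * rho))); [|simpl; lra].
    apply spread_close; [exact (proj1 HL)|lra|].
    intros i Hi; unfold page_loop, spine_mid; rewrite Babs.
    destruct Hj as [-> | ->]; small_index i Hi; simpl; apply Rabs_def1; split_minmax; lra.
  - intros E; rewrite E in E1; unfold x in E1.
    rewrite flatten_page1_spread in E1; unfold spine_mid in E1; simpl in E1.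
    injection E1 as C1 C2.
    assert (Hc0 : cos t = 0) by nra; assert (Hs0 : sin t = 0) by nra.
    pose proof (sin2_cos2 t) as S2; unfold Rsqr in S2; rewrite Hc0, Hs0 in S2; lra.
  - exact E1.
  - unfold y; rewrite flatten_page2_spread, Hsum; f_equal; [unfold page_loop; field|].
    unfold page_loop; destruct Hj as [-> | ->]; simpl; [|rewrite Babs]; split_minmax; lra.
Qed.

Lemma cont_page_loop (rho : R) (j : nat) (D : R -> Prop) :
  cont closeR (closeN N) D (fun t => spread 0 w 5 (page_loop rho j t)).
Proof.
  assert (Hmax : forall f, cont closeR closeR D f -> cont closeR closeR D (fun t => Rmax 0 (f t))).
  { intros f Hf; apply (cont_ext _ _ _ (fun t => / 2 * (f t + Rabs (f t)))).
    - intros t _; unfold Rabs; destruct (Rcase_abs (f t)); split_minmax; lra.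
    - repeat cont_tac; auto.
      apply (cont_comp1 _ _ Rabs); [auto|intros; apply Rcontinuity_abs]. }
  apply cont_spread; [exact closeR_mono|exact (proj1 HL)|].
  intros i _; unfold page_loop; destruct i as [|[|i]].
  - apply (cont_ext _ _ _ (fun t => / 2 * (1 - rho * Rabs (sin t) - rho * cos t)));
      [intros; field|].
    repeat cont_tac; apply (cont_comp1 _ _ Rabs); [repeat cont_tac|intros; apply Rcontinuity_abs].
  - apply Hmax; repeat cont_tac.
  - destruct (_ =? j)%nat; [|cont_tac]; apply Hmax.
    apply (cont_ext _ _ _ (fun t => 0 - rho * sin t)); [intros; ring|repeat cont_tac].
Qed.

Lemma book_not_surface : ~ is_surface_with_boundary N (realization N n1 n2 n3).
Proof.
  pose proof (proj1 HL) as [HN [Hw1 _]].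
  intros HS; refine (book_no_half_plane_chart N X x (flatten_page1 w) (flatten_page2 w) (/ 2)
    _ _ _ _ _ (HS x _)).
  - lra.
  - unfold flatten_page1; repeat cont_tac; apply cont_coord; auto; apply Hw1; lia.
  - unfold flatten_page2; repeat cont_tac; apply cont_coord; auto; apply Hw1; lia.
  - exact flatten_page_zero.
  - intros d Hd; set (rho := Rmin (d / 12) (/ 8)).
    assert (Hrho : 0 < rho) by (apply Rmin_glb_lt; lra).
    assert (Hrho8 : rho <= / 8) by apply Rmin_r.
    assert (Hrhod : 12 * rho <= d) by (pose proof (Rmin_l (d / 12) (/ 8)); unfold rho; lra).
    exists rho, (fun t => spread 0 w 5 (page_loop rho 2 t)),
      (fun t => spread 0 w 5 (page_loop rho 3 t)).
    assert (Hcl : forall j, page_loop rho j (- PI) = page_loop rho j PI).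
    { intros j; unfold page_loop; rewrite sin_neg, cos_neg, sin_PI, Ropp_0; reflexivity. }
    split; [exact Hrho|]; split; [apply cont_page_loop|]; split; [apply cont_page_loop|].
    split; [rewrite Hcl; reflexivity|]; split; [rewrite Hcl; reflexivity|].
    intros t _.
    destruct (page_loop_props rho d 2 t (or_introl eq_refl) Hrho Hrho8 Hrhod)
      as [A1 [A2 [A3 [A4 A5]]]].
    destruct (page_loop_props rho d 3 t (or_intror eq_refl) Hrho Hrho8 Hrhod)
      as [B1 [B2 [B3 [B4 B5]]]].
    simpl in A5, B5; tauto.
  - apply (spread_open_star _ _ _ _ _ _ _ _ HL); [split|].
    + intros i Hi; unfold spine_mid; destruct i; lra.
    + exists 0%nat, 1%nat; split; [simpl; tauto|]; intros l Hl Hl0 _.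
      destruct l; [lia|reflexivity].
    + unfold spine_mid; simpl; lra.
Qed.

End Book.

Theorem theorem6p8 (N n1 n2 n3 : nat)
  (hsum : (n1 + n2 + n3)%nat = N)
  (h1 : (1 <= n1)%nat) (h12 : (n1 <= n2)%nat) (h23 : (n2 <= n3)%nat) (h3 : (n3 < N)%nat) :
  (is_surface_with_boundary N (realization N n1 n2 n3) /\
   exists x, is_boundary_point N (realization N n1 n2 n3) x)
  <->
  ( (n1 = n2 /\ n2 = n3)
  \/ (n1 = n2 /\ (n2 < n3)%nat /\ (2 * n3)%nat <> N)
  \/ ((n1 < n2)%nat /\ n2 = n3) ).
Proof.
  split.
  - intros [Hsurf [x [Hx Hbd]]].
    (* Outside the listed cases three configurations remain: tetrahedra and hexagonal links, where
       planar charts everywhere contradict that [x] is a boundary point, and the book, which is no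
       surface at all. *)
    assert (Hcases : (n1 = n2 /\ n2 < n3 /\ 2 * n3 = N)%nat \/
      (n1 < n2 /\ n2 < n3 /\ 2 * n3 <> N)%nat \/ (n1 < n2 /\ n2 < n3 /\ 2 * n3 = N)%nat \/
      ((n1 = n2 /\ n2 = n3) \/ (n1 = n2 /\ (n2 < n3)%nat /\ (2 * n3)%nat <> N)
       \/ ((n1 < n2)%nat /\ n2 = n3))) by lia.
    destruct Hcases as [[H1 [H2 H3]]|[[H1 [H2 H3]]|[[H1 [H2 H3]]|H]]]; [exfalso..|exact H].
    + apply Hbd; subst n2.
      apply (open_star_charts N n1 n1 n3 3 tetrahedron_edges (tetrahedron_link N n1)
        plane _ _ _ ltac:(intros v Hv; apply link_tetrahedron; lia) tetrahedron_chart x Hx).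
    + apply Hbd.
      apply (open_star_charts N n1 n2 n3 6 hexagon_edges (hexagon_link N n1 n2 n3)
        plane _ _ _ ltac:(intros v Hv; apply link_hexagon; lia) hexagon_chart x Hx).
    + apply (book_not_surface N n1 n2 n3 (book_link n1 n2 n3)); [|exact Hsurf].
      apply link_book; lia.
  - intros [[H1 H2]|[[H1 [H2 H3]]|[H1 H2]]].
    + subst n2 n3.
      apply (surface_with_boundary_of_half_plane_charts N n1 n1 n1 2 triangle_edges
        (triangle_link N n1) triangle_flat triangle_coords 8).
      * lia.
      * intros v Hv; apply link_equal; lia.
      * exact triangle_chart.
      * discriminate.
      * simpl; apply Rmin_left; lra.
    + subst n2.
      apply (surface_with_boundary_of_half_plane_charts N n1 n1 n3 4 fan_edges
        (fan_link N n1) fan_flat fan_coords 8).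
      * lia.
      * intros v Hv; apply link_fan_small; lia.
      * exact fan_chart.
      * discriminate.
      * simpl; lra.
    + subst n3.
      apply (surface_with_boundary_of_half_plane_charts N n1 n2 n2 4 fan_edges
        (fan_link N n2) fan_flat fan_coords 8).
      * lia.
      * intros v Hv; apply link_fan_large; lia.
      * exact fan_chart.
      * discriminate.
      * simpl; lra.
Qed.
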